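(* Let $\mathbf r=(r^{\mathtt v},r^e,r^f)$ be integers with $r^f=m\ge-1$, $r^e\ge\max\{2r^f,-1\}$, $r^{\mathtt v}\ge\max\{2r^e,-1\}$, and let $k\ge2r^{\mathtt v}+1$ be a nonnegative integer. Let $T$ be a tetrahedron. The shape function space $\mathbb P_k(T)$ is uniquely determined by (i.e. unisolvent with respect to) the degrees of freedom (S0) $\nabla^ju(\mathtt v)$, $\mathtt v\in\Delta_0(T)$, $j=0,1,\dots,r^{\mathtt v}$; (S1) $\int_e\frac{\partial^ju}{\partial n_1^i\partial n_2^{j-i}}\,q\,ds$, $e\in\Delta_1(T)$, $q\in\mathbb P_{k-2(r^{\mathtt v}+1)+j}(e)$, $0\le i\le j\le r^e$; (S2) $\int_f\frac{\partial^ju}{\partial n_f^j}\,q\,dS$, $f\in\Delta_2(T)$, $q\in\mathbb B_{k-j}(f;(r^{\mathtt v}-j,r^e-j))$, $0\le j\le r^f$; (S3) $\int_Tu\,q\,dx$, $q\in\mathbb B_k(T;\mathbf r)$. Moreover, for a conforming tetrahedral mesh $\mathcal T_h$ of $\Omega\subset\mathbb R^3$, these degrees of freedom define a global $C^m$-continuous finite element space $$\mathbb V_k(\mathcal T_h;\mathbf r)=\{u\in C^m(\Omega):u|_T\in\mathbb P_k(T)\ \forall T\in\mathcal T_h,\ \text{and all DoFs (S0)–(S3) are single-valued}\},$$ in the sense that every $u$ with $u|_T\in\mathbb P_k(T)$ for all $T\in\mathcal T_h$ and with all DoFs (S0)–(S3) single-valued belongs to $C^m(\Omega)$.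
   Context: $\Delta_\ell(T)$ is the set of $\ell$-dimensional subsimplices of $T$. $\mathbb P_j(K)$ is the space of polynomials of degree $\le j$ on $K$, equal to $\{0\}$ if $j<0$. $\nabla^j$ is the tensor of all $j$-th order partial derivatives. For each edge $e$ two linearly independent normal vectors $n_1,n_2$ are fixed and for each face $f$ a normal vector $n_f$; in a mesh they depend only on $e$, resp. $f$, not on the element containing it. When $m=-1$, $C^{-1}(\Omega)$ imposes no continuity. With barycentric coordinates $\lambda_0,\dots,\lambda_3$ of $T$, let $\mathbb T_k^3=\{\alpha\in\mathbb N^{4}:|\alpha|=k\}$, $\lambda^\alpha=\prod\lambda_i^{\alpha_i}$; identifying a subsimplex $g$ with its set of vertex indices, put $\operatorname{dist}(\alpha,g)=\sum_{i\notin g}\alpha_i$. Then $\mathbb B_k(T;\mathbf r)=\operatorname{span}\{\lambda^\alpha:\alpha\in\mathbb T_k^3,\ \operatorname{dist}(\alpha,\mathtt v)>r^{\mathtt v},\ \operatorname{dist}(\alpha,e)>r^e,\ \operatorname{dist}(\alpha,f)>r^f$ for all vertices $\mathtt v$, edges $e$, faces $f$ of $T\}$. For a triangle $f$, $\mathbb B_k(f;(a,b))$ is the span of the degree $k$ monomials $\lambda_f^{\alpha}$ in the barycentric coordinates of $f$ with $\operatorname{dist}(\alpha,\mathtt v)>a$ for all vertices and $\operatorname{dist}(\alpha,e)>b$ for all edges of $f$ (dist taken within $f$). Unisolvent means: taking bases of the test spaces and counting the distinct partial derivatives, the number of DoFs equals $\dim\mathbb P_k(T)$, and a function in $\mathbb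 P_k(T)$ for which all DoFs vanish is zero. A DoF is single-valued if it takes the same value computed from each tetrahedron containing the subsimplex. *)

(* Defs.v *)
From HB Require Import structures.
From mathcomp Require Import all_boot all_order all_algebra.
(* The notations of mpoly clash with those of the analysis library. *)
From mathcomp Require Import -(notations) mpoly.
From mathcomp Require Import all_classical all_reals all_analysis.
Set Implicit Arguments.
Unset Strict Implicit.
Unset Printing Implicit Defensive.
Import Order.TTheory GRing.Theory Num.Theory.
Import numFieldNormedType.Exports.
Local Open Scope classical_set_scope.
Local Open Scope ring_scope.

(* Simplices are given combinatorially, as finite sets [g : {set V}] of vertex
   labels, together with the position [x v] in R^3 of each vertex; a subsimplex
   shared by several tetrahedra of a mesh is thus literally the same set. *)

Section Simplices.
Context {R : realType} {V : finType}.
Variable x : V -> 'rV[R]_3.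
Implicit Types (g h : {set V}) (p : 'rV[R]_3) (l : {ffun V -> R}).

(* $\Delta_\ell(g)$ *)
Definition Delta (d : nat) g : {set {set V}} :=
  [set h : {set V} | (h \subset g) && (#|h| == d.+1)].

Definition is_bary g p l : Prop :=
  [/\ forall v, v \notin g -> l v = 0,
      \sum_v l v = 1 & \sum_v l v *: x v = p].

(* For an affinely independent [g] the coordinates are unique.  They exist only
   on the affine hull of [g] (all of R^3 for a tetrahedron); elsewhere the value
   is the irrelevant default 0. *)
Definition bary g p : {ffun V -> R} := xget [ffun=> 0] (is_bary g p).

Definition simplex g : set 'rV[R]_3 :=
  [set p | exists l, is_bary g p l /\ forall v, 0 <= l v].

Definition affinely_independent g : Prop :=
  forall l, (forall v, v \notin g -> l v = 0) ->
    \sum_v l v = 0 -> \sum_v l v *: x v = 0 -> forall v, l v = 0.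

Definition tetrahedron g : Prop := #|g| = 4%N /\ affinely_independent g.

End Simplices.

Section FunctionSpaces.
Context {R : realType}.
Notation E := ('rV[R]_3).

(* Polynomial functions of degree at most [d]; only 0 when [d < 0].
   $\mathbb P_d(K)$ consists of their restrictions to [K]. *)
Definition polyspace (d : int) : set (E -> R) :=
  [set u | exists P : mpoly 3 R,
     (forall a : multinom 3, a \in msupp P -> (mdeg a)%:Z <= d) /\
     u = (fun p : E => meval (fun i => p 0 i) P)].

Context {V : finType}.
Variable x : V -> E.

(* The exponents $\alpha$ supported in [g] with $|\alpha| = k$ and
   $\operatorname{dist}(\alpha,h) > r_\ell$ for all $\ell$-dimensional
   subsimplices [h] of [g], for each $\ell$ below the length of [r]. *)
Definition bubble_index (g : {set V}) (k : nat) (r : seq int) :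
    {set {ffun V -> 'I_k.+1}} :=
  [set a : {ffun V -> 'I_k.+1} |
    [&& [forall v, (v \notin g) ==> (a v == 0 :> nat)],
        (\sum_(v in g) a v)%N == k
      & [forall l : 'I_(size r), forall h in Delta l g,
           r`_l < ((\sum_(v in g :\: h) a v)%N)%:Z]]].

(* $\mathbb B_k(g; r)$, with [r = [:: r^v; r^e; r^f]] for a tetrahedron and
   [r = [:: a; b]] for a triangle. *)
Definition bubble (g : {set V}) (k : nat) (r : seq int) : set (E -> R) :=
  [set q | exists c : {ffun V -> 'I_k.+1} -> R,
     q = (fun p : E => \sum_(a in bubble_index g k r)
                     c a * \prod_(v in g) bary x g p v ^+ a v)].

End FunctionSpaces.

Section Dimension.
Context {R : realType} {X : Type}.

Definition basis_on (D : set X) (S : set (X -> R)) n (b : 'I_n -> X -> R) : Prop :=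
  [/\ forall i, S (b i),
      forall c : 'I_n -> R,
        (forall p, D p -> \sum_i c i * b i p = 0) -> forall i, c i = 0
    & forall q, S q ->
        exists c : 'I_n -> R, forall p, D p -> q p = \sum_i c i * b i p].

(* The dimension of the space of restrictions to [D] of the functions in [S];
   the default 0 would only be used for an infinite-dimensional space. *)
Definition dim_on (D : set X) (S : set (X -> R)) : nat :=
  xget 0%N [set n : nat | exists b : 'I_n -> X -> R, basis_on D S b].

End Dimension.

Section Calculus.
Context {R : realType}.
Notation E := ('rV[R]_3).
Notation leb := (@lebesgue_measure R).
Implicit Types (u w : E -> R) (p : E).

Definition e_ (i : 'I_3) : E := delta_mx 0 i.

Definition partials (s : seq 'I_3) u : E -> R :=
  foldr (fun i w => 'D_(e_ i) w) u s.

Definition iterD (n : E) (j : nat) u : E -> R := iter j (fun w => 'D_n w) u.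

Fixpoint class_C (n : nat) (Omega : set E) w : Prop :=
  (forall p, Omega p -> {for p, continuous w}) /\
  if n is n'.+1 then
    forall i, (forall p, Omega p -> derivable w p (e_ i)) /\
              class_C n' Omega ('D_(e_ i) w)
  else True.

Definition dot (a b : E) : R := (a *m b^T) 0 0.

Context {V : finType}.
Variable x : V -> E.

Definition vertex (g : {set V}) (i : nat) : E := nth 0 [seq x v | v <- enum g] i.

(* Line and surface integrals, through the affine parametrization of [g] by the
   reference interval, resp. triangle; the factor is the square root of the Gram
   determinant. *)
Definition int_edge (g : {set V}) w : R :=
  let a := vertex g 0 in let d := vertex g 1 - a in
  Num.sqrt (dot d d) * \int[leb]_(t in `[0, 1]) w (a + t *: d).

Definition int_face (g : {set V}) w : R :=
  let a := vertex g 0 in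
  let d1 := vertex g 1 - a in let d2 := vertex g 2 - a in
  Num.sqrt (dot d1 d1 * dot d2 d2 - dot d1 d2 ^+ 2) *
  \int[(leb \x leb)%E]_(t in
      [set t | [/\ 0 <= t.1, 0 <= t.2 & t.1 + t.2 <= 1]])
    w (a + t.1 *: d1 + t.2 *: d2).

Definition point3 (t : R * R * R) : E := \row_i [:: t.1.1; t.1.2; t.2]`_i.

Definition int_tet (g : {set V}) w : R :=
  \int[((leb \x leb) \x leb)%E]_(t in
      [set t | simplex x g (point3 t)]) w (point3 t).

Definition normal_to (g : {set V}) (n : E) : Prop :=
  forall a b : V, a \in g -> b \in g -> dot (x a - x b) n = 0.

Definition edge_normals (g : {set V}) (n1 n2 : E) : Prop :=
  [/\ normal_to g n1, normal_to g n2 & row_free (col_mx n1 n2)].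

Definition face_normal (g : {set V}) (n : E) : Prop := normal_to g n /\ n != 0.

End Calculus.

Section Elements.
Context {R : realType} {V : finType}.
Notation E := ('rV[R]_3).
Variables (x : V -> E) (rv re rf : int) (k : nat).
Variables (n1 n2 nf : {set V} -> E).
Implicit Types (T g : {set V}).

Definition normals_on T : Prop :=
  (forall e, e \in Delta 1 T -> edge_normals x e (n1 e) (n2 e)) /\
  (forall f, f \in Delta 2 T -> face_normal x f (nf f)).

(* [dof g l]: the functional [l] is one of the degrees of freedom attached to
   the simplex [g] (vertex, edge, face or tetrahedron). A sequence [s] of
   directions of size [j] picks one component of $\nabla^j$.  In [dof_face] the
   subtraction [k - j] is not truncated under the standing assumptions. *)
Inductive dof g : ((E -> R) -> R) -> Prop :=
| dof_vertex (v : V) (s : seq 'I_3) of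
    g = [set v]%SET & (size s)%:Z <= rv :
    dof g (fun u => partials s u (x v))
| dof_edge (i j : nat) (q : E -> R) of
    #|g| = 2%N & (i <= j)%N & j%:Z <= re
    & polyspace (k%:Z - 2 * (rv + 1) + j%:Z) q :
    dof g (fun u => int_edge x g (fun p =>
      iterD (n1 g) i (iterD (n2 g) (j - i) u) p * q p))
| dof_face (j : nat) (q : E -> R) of
    #|g| = 3%N & j%:Z <= rf
    & bubble x g (k - j) [:: rv - j%:Z; re - j%:Z] q :
    dof g (fun u => int_face x g (fun p =>
      iterD (nf g) j u p * q p))
| dof_tet (q : E -> R) of
    #|g| = 4%N & bubble x g k [:: rv; re; rf] q :
    dof g (fun u => int_tet x g (fun p => u p * q p)).

(* The orders $0 \le j \le r$, for [-1 <= r], are the [j < norders r]; the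
   distinct partial derivatives of order at most [rv] are indexed by the
   multi-indices of degree less than [norders rv]. *)
Definition norders (r : int) : nat := absz (r + 1).

Definition number_of_dofs T : nat :=
  (\sum_(v in T) #|{: bmultinom 3 (norders rv)}|
   + \sum_(e in Delta 1 T) \sum_(j < norders re) \sum_(i < j.+1)
       dim_on (simplex x e) (@polyspace R (k%:Z - 2 * (rv + 1) + j%:Z)%R)
   + \sum_(f in Delta 2 T) \sum_(j < norders rf)
       dim_on (simplex x f) (bubble x f (k - j) [:: (rv - j%:Z)%R; (re - j%:Z)%R])
   + dim_on (simplex x T) (bubble x T k [:: rv; re; rf]))%N.

Definition unisolvent T : Prop :=
  number_of_dofs T = dim_on (simplex x T) (@polyspace R k%:Z) /\
  forall u, polyspace k%:Z u ->
    (forall g l, g \subset T -> dof g l -> l u = 0) ->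
    forall p, simplex x T p -> u p = 0.

Record conforming_mesh (Th : {set {set V}}) (Omega : set E) : Prop := {
  mesh_open : open Omega;
  mesh_cover : closure Omega = \bigcup_(T in [set` Th]) simplex x T;
  mesh_tetrahedra : forall T, T \in Th -> tetrahedron x T;
  mesh_conforming : forall T T', T \in Th -> T' \in Th ->
    simplex x T `&` simplex x T' = simplex x (T :&: T')
}.

(* A piecewise polynomial is a family [u], with [u T] the polynomial extension
   of its restriction to [T]; it may be multivalued on the interelement
   boundaries. *)
Variables (Th : {set {set V}}) (Omega : set E).
Implicit Type u : {set V} -> E -> R.

Definition piecewise_C (m : int) u : Prop :=
  if m is Posz n then
    exists w : E -> R,
      (forall T p, T \in Th -> simplex x T p -> Omega p -> w p = u T p) /\
      class_C n Omega w
  else True.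

Definition single_valued u : Prop :=
  forall T T' g l, T \in Th -> T' \in Th -> g \subset T -> g \subset T' ->
    dof g l -> l (u T) = l (u T').

(* $\mathbb V_k(\mathcal T_h; \mathbf r)$ *)
Definition fe_space (m : int) : set ({set V} -> E -> R) :=
  [set u | [/\ piecewise_C m u,
               forall T, T \in Th -> polyspace k%:Z (u T)
             & single_valued u]].

End Elements.

(* Main.v *)
(* A polynomial on a tetrahedron T is expanded in the Bernstein monomials
   lambda^a, |a| = k.  The normal derivatives of order j at a relative interior
   point of a subsimplex g only see the exponents with dist(a, g) <= j, and the
   coefficients with dist(a, g) = j can be read off from them.  Hence, working
   through vertices, edges and faces in this order, the vanishing of the degrees
   of freedom on g kills all coefficients with dist(a, g) <= r^g: on an edge the
   derivative is (lambda_0 lambda_1)^s times an admissible test function, on a face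
   it is itself a bubble, and testing it against that function gives the
   integral of a nonnegative polynomial.  What is left is a bubble of T, killed by
   (S3).  The same exponents, sorted by the first subsimplex they are close to,
   count the degrees of freedom.

   On a mesh, the difference of the polynomials of T and T' has vanishing
   degrees of freedom on g = T :&: T', so that its derivatives of order at
   most m <= r^g vanish on g. *)
Require Import Defs.
From HB Require Import structures.
From mathcomp Require Import all_boot all_order all_algebra.
From mathcomp Require Import -(notations) mpoly.
From mathcomp Require Import all_classical all_reals all_analysis.
From mathcomp Require Import measurable_realfun ring lra zify.
Set Implicit Arguments.
Unset Strict Implicit.
Unset Printing Implicit Defensive.
Import Order.TTheory GRing.Theory Num.Theory.
Import numFieldNormedType.Exports.
Local Open Scope classical_set_scope.
Local Open Scope ring_scope.

(** The state of the elimination is one function [r] on the faces of T: [spn k r] says that only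
    exponents with dist(a, g) > r g occur. A stage raises one entry of [r], a derivative lowers
    every entry by one. The obstacle in reading off coefficients is that the fixed normals are not
    aligned with the barycentric directions. It suffices that normal directions realise every choice
    of derivatives of the lambda_w, w not in g. These values and the coordinates of a point of g
    then sweep out the positive orthant up to scaling, where distinct monomials are independent. The
    inequalities between k, r^v, r^e, r^f enter the count through dist(a, g :&: h) <= dist(a, g) +
    dist(a, h): an exponent close to two faces of equal dimension is close to their intersection,
    and the empty set is at distance k. The elimination is stated for any face g of T and uses only
    degrees of freedom on subsets of g; hence it serves both unisolvence (g = T) and conformity (g
    shared by two tetrahedra). *)

(** * Polynomials in three variables as functions, with formal directional derivatives *)

Section PolynomialFunctions.
Context {R : realType}.
Notation E := ('rV[R]_3).
Notation poly3 := (mpoly 3 R).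
Implicit Types (P Q : poly3) (p h : E).

Definition ev P p : R := meval (fun i => p 0 i) P.

Lemma evD P Q p : ev (P + Q) p = ev P p + ev Q p. Proof. exact: mevalD. Qed.
Lemma evB P Q p : ev (P - Q) p = ev P p - ev Q p. Proof. exact: mevalB. Qed.
Lemma evM P Q p : ev (P * Q) p = ev P p * ev Q p. Proof. exact: mevalM. Qed.
Lemma evZ c P p : ev (c *: P) p = c * ev P p. Proof. exact: mevalZ. Qed.
Lemma evC c p : ev (mpolyC 3 c) p = c. Proof. exact: mevalC. Qed.
Lemma ev0 p : ev 0 p = 0. Proof. exact: meval0. Qed.
Lemma ev1 p : ev 1 p = 1. Proof. exact: meval1. Qed.
Lemma evX P n p : ev (P ^+ n) p = ev P p ^+ n. Proof. exact: rmorphXn. Qed.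
Lemma ev_sum (I : Type) (r : seq I) (B : pred I) (F : I -> poly3) p :
  ev (\sum_(i <- r | B i) F i) p = \sum_(i <- r | B i) ev (F i) p.
Proof. exact: raddf_sum. Qed.
Lemma ev_prod (I : Type) (r : seq I) (B : pred I) (F : I -> poly3) p :
  ev (\prod_(i <- r | B i) F i) p = \prod_(i <- r | B i) ev (F i) p.
Proof. exact: rmorph_prod. Qed.

Definition pX (i : 'I_3) : poly3 := mpolyX R (mnm1 i).

Lemma ev_pX i p : ev (pX i) p = p 0 i. Proof. exact: mevalXU. Qed.

(** Continuity, differentiability, measurability and boundedness all pass from constants and
    coordinates through sums and products; this is the common induction. *)
Lemma pol_ind (C : poly3 -> Prop) :
  (forall c, C (mpolyC 3 c)) -> (forall i, C (pX i)) ->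
  (forall P Q, C P -> C Q -> C (P + Q)) ->
  (forall P Q, C P -> C Q -> C (P * Q)) -> forall P, C P.
Proof.
move=> C0 CX CD CM P; rewrite [P]mpolyE.
apply: big_ind => [|Q1 Q2|m _]; [by rewrite -mpolyC0|exact: CD|].
rewrite -mul_mpolyC; apply: (CM) => //; rewrite mpolyXE_id.
apply: big_ind => [|Q1 Q2|i _]; [by rewrite -mpolyC1|exact: CM|].
elim: (m i) => [|n IH]; [by rewrite expr0 -mpolyC1|by rewrite exprS; apply: (CM) => //; exact: CX].
Qed.

Lemma continuous_ev P : continuous (ev P).
Proof.
elim/pol_ind: P => [c|i|P Q cP cQ|P Q cP cQ] p.
- by rewrite (_ : ev _ = cst c); [exact: cst_continuous|apply/funext => q; rewrite evC].
- rewrite (_ : ev _ = fun q : E => q 0 i); first exact: coord_continuous.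
  by apply/funext => q; rewrite ev_pX.
- rewrite (_ : ev _ = ev P \+ ev Q); first exact: (cvgD (cP p) (cQ p)).
  by apply/funext => q; rewrite evD.
- rewrite (_ : ev _ = ev P \* ev Q); first exact: (cvgM (cP p) (cQ p)).
  by apply/funext => q; rewrite evM.
Qed.

Definition dirD h P : poly3 := \sum_(i < 3) h 0 i *: mderiv i P.

Lemma dirDD h P Q : dirD h (P + Q) = dirD h P + dirD h Q.
Proof. by rewrite /dirD -big_split; apply: eq_bigr => i _; rewrite mderivD scalerDr. Qed.

Lemma dirDZ h c P : dirD h (c *: P) = c *: dirD h P.
Proof.
rewrite /dirD scaler_sumr; apply: eq_bigr => i _.
by rewrite mderivZ !scalerA mulrC.
Qed.

Lemma dirDB h P Q : dirD h (P - Q) = dirD h P - dirD h Q.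
Proof. by rewrite dirDD -scaleN1r dirDZ scaleN1r. Qed.

Lemma dirD0 h : dirD h 0 = 0.
Proof. by rewrite /dirD big1 // => i _; rewrite mderiv0 scaler0. Qed.

Lemma dirDC h c : dirD h (mpolyC 3 c) = 0.
Proof. by rewrite /dirD big1 // => i _; rewrite mderivC scaler0. Qed.

Lemma dirD_pX h i : dirD h (pX i) = mpolyC 3 (h 0 i).
Proof.
rewrite /dirD (bigD1 i) //= big1 => [|j ji]; rewrite mderivX mnm1E.
  rewrite eqxx addr0 scale1r -alg_mpolyC -mpolyX0; congr (_ *: mpolyX _ _).
  by apply/mnmP => l; rewrite mnmBE mnm0E subnn.
by rewrite eq_sym (negPf ji) scale0r scaler0.
Qed.

Lemma dirDM h P Q : dirD h (P * Q) = dirD h P * Q + P * dirD h Q.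
Proof.
rewrite /dirD mulr_suml mulr_sumr -big_split; apply: eq_bigr => i _ /=.
by rewrite mderivM scalerDr scalerAl scalerAr.
Qed.

Lemma dirD_sum h (I : Type) (r : seq I) (B : pred I) (F : I -> poly3) :
  dirD h (\sum_(i <- r | B i) F i) = \sum_(i <- r | B i) dirD h (F i).
Proof. by apply: (big_morph (dirD h)); [exact: dirDD|exact: dirD0]. Qed.

Lemma dirD_comm h h' P : dirD h (dirD h' P) = dirD h' (dirD h P).
Proof.
have E2 g g' : dirD g (dirD g' P) =
    \sum_(i < 3) \sum_(j < 3) (g 0 i * g' 0 j) *: mderiv i (mderiv j P).
  rewrite /dirD; apply: eq_bigr => i _; rewrite (raddf_sum (mderiv i)) scaler_sumr.
  by apply: eq_bigr => j _; rewrite /= mderivZ scalerA.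
rewrite !E2 exchange_big; apply: eq_bigr => i _; apply: eq_bigr => j _.
by rewrite mderiv_comm mulrC.
Qed.

Lemma dirD_addv h h' P : dirD (h + h') P = dirD h P + dirD h' P.
Proof. by rewrite /dirD -big_split; apply: eq_bigr => i _; rewrite mxE scalerDl. Qed.

Lemma dirD_scalev c h P : dirD (c *: h) P = c *: dirD h P.
Proof. by rewrite /dirD scaler_sumr; apply: eq_bigr => i _; rewrite mxE scalerA. Qed.

Lemma dirD_sumv (I : Type) (r : seq I) (F : I -> E) P :
  dirD (\sum_(i <- r) F i) P = \sum_(i <- r) dirD (F i) P.
Proof.
apply: (big_morph (fun h => dirD h P)) => [h h'|]; first exact: dirD_addv.
by rewrite -[X in dirD X](scale0r 0) dirD_scalev scale0r.
Qed.

Lemma is_derive_ev P p h : is_derive p h (ev P) (ev (dirD h P) p).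
Proof.
elim/pol_ind: P => [c|i|P Q dP dQ|P Q dP dQ].
- rewrite dirDC ev0 (_ : ev _ = cst c); first exact: is_derive_cst.
  by apply/funext => q; rewrite evC.
- rewrite dirD_pX evC (_ : ev _ = fun q : E => q 0 i); last first.
    by apply/funext => q; rewrite ev_pX.
  (* The difference quotient of a coordinate function is constant away from t = 0. *)
  have quot : (fun t : R => t^-1 *: ((p + t *: h) 0 i - p 0 i)) @ 0^' --> h 0 i.
    apply: (cvg_trans _ (@cvg_cst _ (h 0 i) _ (0 : R)^' _)).
    apply: near_eq_cvg; near=> t; rewrite !mxE addrC addKr.
    rewrite /GRing.scale/= mulrA mulVf ?mul1r//.
    by near: t; exact: nbhs_dnbhs_neq.
  have quot' : (fun t : R => t^-1 *: (((fun q : E => q 0 i) \o shift p) (t *: h) - p 0 i))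
      @ 0^' --> h 0 i.
    apply: cvg_trans quot; apply: near_eq_cvg; near=> t.
    by rewrite /= [t *: h + p]addrC.
  split; [by apply/cvg_ex; exists (h 0 i)|exact: cvg_lim].
- rewrite dirDD evD (_ : ev (P + Q) = ev P + ev Q); first exact: is_deriveD.
  by apply/funext => q; rewrite evD.
- rewrite dirDM evD !evM (_ : ev (P * Q) = ev P * ev Q); last first.
    by apply/funext => q; rewrite evM.
  apply: is_derive_eq; rewrite /GRing.scale/=; ring.
Unshelve. all: by end_near.
Qed.

Lemma derive_ev h P : 'D_h (ev P) = ev (dirD h P).
Proof. by apply/funext => p; apply: derive_val; exact: is_derive_ev. Qed.

Definition itD h j P := iter j (dirD h) P.

Lemma iterD_ev h j P : Defs.iterD h j (ev P) = ev (itD h j P).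
Proof. by elim: j => //= j IH; rewrite /Defs.iterD /= -/(Defs.iterD _ _ _) IH derive_ev. Qed.

Definition dirs (s : seq 'I_3) P : poly3 := foldr (fun i Q => dirD (e_ i) Q) P s.

Lemma partials_ev s P : partials s (ev P) = ev (dirs s P).
Proof. by elim: s => //= i s ->; rewrite derive_ev. Qed.

Definition deg_le (d : int) P := forall a : multinom 3, a \in msupp P -> (mdeg a)%:Z <= d.

Lemma polyspaceP d u : polyspace d u <-> exists2 P, deg_le d P & u = ev P.
Proof. by split=> [[P [? ->]]|[P ? ->]]; exists P. Qed.

Lemma deg_leD d P Q : deg_le d P -> deg_le d Q -> deg_le d (P + Q).
Proof. by move=> dP dQ a /msuppD_le; rewrite mem_cat => /orP[/dP|/dQ]. Qed.

Lemma deg_leZ d c P : deg_le d P -> deg_le d (c *: P).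
Proof. by move=> dP a /msuppZ_le /dP. Qed.

Lemma deg_leB d P Q : deg_le d P -> deg_le d Q -> deg_le d (P - Q).
Proof. by move=> dP dQ; rewrite -scaleN1r; apply: deg_leD => //; apply: deg_leZ. Qed.

Lemma deg_le0 d : deg_le d 0.
Proof. by move=> a; rewrite msupp0. Qed.

Lemma deg_leC c : deg_le 0 (mpolyC 3 c).
Proof. by move=> a; rewrite msuppC; case: ifP => // _; rewrite inE => /eqP->; rewrite mdeg0. Qed.

Lemma deg_le_pX i : deg_le 1 (pX i).
Proof. by move=> a; rewrite msuppX inE => /eqP ->; rewrite mdeg1. Qed.

Lemma deg_leM d d' P Q : deg_le d P -> deg_le d' Q -> deg_le (d + d') (P * Q).
Proof.
move=> dP dQ a /msuppM_le /allpairsP[[a1 a2] /= [/dP h1 /dQ h2 ->]].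
by rewrite mdegD PoszD lerD.
Qed.

Lemma deg_le_lt0 d P : d < 0 -> deg_le d P -> P = 0.
Proof.
move=> d0 dP; apply/eqP; rewrite -msupp_eq0; case E: (msupp P) => [//|a s].
have aP : a \in msupp P by rewrite E inE eqxx.
by have := le_lt_trans (dP _ aP) d0.
Qed.

Lemma deg_leW d d' P : d <= d' -> deg_le d P -> deg_le d' P.
Proof. by move=> dd' dP a /dP /le_trans; apply. Qed.

Lemma deg_leX d P n : deg_le d P -> deg_le (d *+ n) (P ^+ n).
Proof.
move=> dP; elim: n => [|n IH]; first by rewrite expr0 -mpolyC1; exact: deg_leC.
by rewrite exprS mulrS; exact: deg_leM.
Qed.

End PolynomialFunctions.

(** * Barycentric coordinates of T as affine polynomials *)

Section BarycentricPolynomials.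
Context {R : realType} {V : finType}.
Notation E := ('rV[R]_3).
Notation poly3 := (mpoly 3 R).
Variables (x : V -> E) (T : {set V}).

(** [L v] is lambda_v as a formal polynomial, so that derivatives become algebra; since it is
    affine, its derivative along [h] is a constant [dl h v]. Later arguments use these properties
    and not the construction. *)
Record bary_polys (L : V -> poly3) (dl : E -> V -> R) : Prop := BaryPolys {
  bary_sum1 : \sum_(v in T) L v = 1;
  bary_sumx : forall i, \sum_(v in T) x v 0 i *: L v = pX i;
  bary_notin : forall v, v \notin T -> L v = 0;
  bary_dirD : forall h v, dirD h (L v) = mpolyC 3 (dl h v);
  bary_deg : forall v, deg_le 1 (L v) }.

(** The rows (1, x_v) form a matrix [M] that affine independence makes row free; having four rows it
    is invertible, and the coordinates of p are (1, p) times the inverse. *)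
Lemma bary_polys_exist : tetrahedron x T -> exists L dl, bary_polys L dl.
Proof.
move=> [cT aT].
pose M : 'M[R]_(#|T|, 1 + 3) := \matrix_(i < #|T|) row_mx 1%:M (x (enum_val i)).
have fM : row_free M.
  rewrite -kermx_eq0; apply/eqP/row_matrixP => i0.
  set y := row i0 _; have yM : y *m M = 0 by rewrite /y -row_mul mulmx_ker row0.
  (* A kernel vector indexed by the enumeration of T is turned into a family on V, extended by 0, so
     that affine independence applies. *)
  pose l := [ffun v => \sum_(i < #|T|) if enum_val i == v then y 0 i else 0].
  have suml (F : V -> R) : \sum_v l v * F v = \sum_i y 0 i * F (enum_val i).
    under eq_bigr do rewrite ffunE mulr_suml.
    rewrite exchange_big; apply: eq_bigr => i _ /=.
    rewrite (bigD1 (enum_val i)) //= eqxx big1 ?addr0 // => v vi.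
    by rewrite eq_sym (negPf vi) mul0r.
  have l0 : forall v, l v = 0.
    refine (aT l _ _ _) => [v vT||].
    - rewrite ffunE big1 // => i _; case: eqP => // iv.
      by move: vT; rewrite -iv enum_valP.
    - transitivity (\sum_v l v * 1); first by apply: eq_bigr => v _; rewrite mulr1.
      rewrite suml; have /rowP/(_ (lshift 3 ord0)) := yM; rewrite !mxE => e; rewrite -[RHS]e.
      by apply: eq_bigr => i _; rewrite [M _ _]mxE row_mxEl [_%:M _ _]mxE.
    - apply/rowP => a; rewrite summxE !mxE; under eq_bigr do rewrite !mxE.
      rewrite (suml (fun v => x v 0 a)).
      have /rowP/(_ (rshift 1 a)) := yM; rewrite !mxE => e; rewrite -[RHS]e.
      by apply: eq_bigr => i _; rewrite [M _ _]mxE row_mxEr.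
  apply/rowP => i; transitivity (l (enum_val i)); last by rewrite l0 !mxE.
  rewrite ffunE.
  rewrite (bigD1 i) //= eqxx big1 ?addr0 // => j ji.
  by case: eqP => // /enum_val_inj ij; rewrite ij eqxx in ji.
have NM : pinvmx M *m M = 1%:M.
  by apply: mulVpmx; rewrite /row_full (eqP fM) cT.
pose N := pinvmx M.
pose Y (a : 'I_(1 + 3)) : poly3 :=
  match fintype.split a with inl _ => 1 | inr i => pX i end.
pose L v : poly3 := \sum_(i < #|T|)
  if enum_val i == v then \sum_a N a i *: Y a else 0.
have dY h a : exists c, dirD h (Y a) = mpolyC 3 c.
  rewrite /Y; case: (fintype.split a) => [_|i]; last by exists (h 0 i); rewrite dirD_pX.
  by exists 0; rewrite -mpolyC1 dirDC.
have dL h v : exists c, dirD h (L v) = mpolyC 3 c.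
  rewrite /L dirD_sum; apply: (big_ind (fun Q => exists c, Q = mpolyC 3 c)) => [|P Q [c ->] [d ->]|i _].
  - by exists 0; rewrite mpolyC0.
  - by exists (c + d); rewrite mpolyCD.
  - case: ifP => _; last by exists 0; rewrite dirD0 mpolyC0.
    rewrite dirD_sum; apply: (big_ind (fun Q => exists c, Q = mpolyC 3 c)) => [|P Q [c ->] [d ->]|a _].
    + by exists 0; rewrite mpolyC0.
    + by exists (c + d); rewrite mpolyCD.
    + have [c dc] := dY h a; exists (N a i * c).
      by rewrite dirDZ dc mpolyCM mul_mpolyC.
(* The identity [N *m M = 1] read in column b: b = 0 gives the partition of unity, the other columns
   reproduce the coordinate functions. *)
have sumL (b : 'I_(1 + 3)) :
    \sum_(v in T) (row_mx 1%:M (x v) : 'rV_(1 + 3)) 0 b *: L v = Y b.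
  transitivity (\sum_(i < #|T|) M i b *: (\sum_a N a i *: Y a)).
    rewrite big_enum_val; apply: eq_bigr => i _; rewrite [M _ _]mxE; congr (_ *: _).
    rewrite /L (bigD1 i) //= eqxx [X in _ + X]big1 ?addr0 // => j ji.
    by case: eqP => // /enum_val_inj ij; rewrite ij eqxx in ji.
  under eq_bigr do rewrite scaler_sumr.
  rewrite exchange_big (bigD1 b) //= [X in _ + X]big1 ?addr0 => [|a ab].
    under eq_bigr do rewrite scalerA mulrC.
    rewrite -scaler_suml.
    have /matrixP/(_ b b) := NM; rewrite !mxE eqxx => ->.
    by rewrite scale1r.
  under eq_bigr do rewrite scalerA mulrC.
  rewrite -scaler_suml.
  have /matrixP/(_ a b) := NM; rewrite !mxE (negPf ab) => ->.
  by rewrite scale0r.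
exists L, (fun h v => sval (cid (dL h v))); split.
- rewrite -[RHS](_ : Y (lshift 3 ord0) = 1); last first.
    by rewrite /Y; case: split_ordP => // i /eqP; rewrite eq_lrshift.
  rewrite -sumL; apply: eq_bigr => v _.
  by rewrite row_mxEl mxE scale1r.
- move=> i; rewrite -[RHS](_ : Y (rshift 1 i) = pX i); last first.
    rewrite /Y; case: split_ordP => [j /eqP|j /rshift_inj ->//].
    by rewrite eq_rlshift.
  by rewrite -sumL; apply: eq_bigr => v _; rewrite row_mxEr.
- move=> v vT; rewrite /L big1 // => i _; case: eqP => // iv.
  by move: vT; rewrite -iv enum_valP.
- by move=> h v; case: cid.
- move=> v; rewrite /L; apply: (big_ind (deg_le 1)) => [|P Q|i _]; [exact: deg_le0|exact: deg_leD|].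
  case: ifP => _; last exact: deg_le0.
  apply: (big_ind (deg_le 1)) => [|P Q|a _]; [exact: deg_le0|exact: deg_leD|].
  apply: deg_leZ; rewrite /Y; case: (fintype.split a) => [_|j]; last exact: deg_le_pX.
  by rewrite -mpolyC1; apply: (@deg_leW _ 0) => //; exact: deg_leC.
Qed.

Section Coordinates.
Variables (L : V -> poly3) (dl : E -> V -> R).
Hypotheses (hT : tetrahedron x T) (hL : bary_polys L dl).
Implicit Types (g : {set V}) (p h : E) (v w : V) (l : {ffun V -> R}).

Definition bc p : {ffun V -> R} := [ffun v => ev (L v) p].

Lemma sum_in_T (W : nmodType) (F : V -> W) :
  (forall v, v \notin T -> F v = 0) -> \sum_v F v = \sum_(v in T) F v.
Proof. by move=> F0; rewrite [LHS](bigID (mem T)) /= [X in _ + X]big1 ?addr0. Qed.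

Lemma bc_notin p v : v \notin T -> bc p v = 0.
Proof. by move=> vT; rewrite ffunE (bary_notin hL) // ev0. Qed.

Lemma bc_is_bary p : is_bary x T p (bc p).
Proof.
split=> [v||]; first exact: bc_notin.
- rewrite sum_in_T => [|v]; last exact: bc_notin.
  by under eq_bigr do rewrite ffunE; rewrite -ev_sum (bary_sum1 hL) ev1.
- rewrite sum_in_T => [|v vT]; last by rewrite bc_notin // scale0r.
  apply/rowP => i; rewrite summxE -ev_pX -(bary_sumx hL) ev_sum.
  by apply: eq_bigr => v _; rewrite !mxE evZ mulrC ffunE.
Qed.

(** Coordinates with respect to a face, extended by 0, are also coordinates with respect to T, and
    those are unique by affine independence. *)
Lemma bary_bc g p l : g \subset T -> is_bary x g p l -> l = bc p.
Proof.
move=> gT [l0 l1 lp]; have [b0 b1 bp] := bc_is_bary p.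
apply/ffunP => v; apply/eqP; rewrite -subr_eq0; apply/eqP.
suff : [ffun w => l w - bc p w] v = 0 by rewrite ffunE.
apply: hT.2 => [w wT||].
- by rewrite ffunE b0 // l0 ?subr0 //; exact: contra (fintype.subsetP gT w) wT.
- by under eq_bigr do rewrite ffunE; rewrite sumrB l1 b1 subrr.
- by under eq_bigr do rewrite ffunE scalerBl; rewrite sumrB lp bp subrr.
Qed.

Lemma bary_eq_bc g p : g \subset T -> (forall v, v \notin g -> bc p v = 0) ->
  bary x g p = bc p.
Proof.
move=> gT p0; have [b0 b1 bp] := bc_is_bary p.
apply: (bary_bc gT); rewrite /bary; case: xgetP => [y _ //|/(_ (bc p))].
by case; split.
Qed.

Lemma simplex_bc g p : g \subset T ->
  simplex x g p <-> (forall v, v \notin g -> bc p v = 0) /\ forall v, 0 <= bc p v.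
Proof.
move=> gT; split=> [[l [lb l0]]|[b0 bge]].
  by have e := bary_bc gT lb; case: lb => l0' _ _; rewrite -e.
by exists (bc p); split => //; have [_ b1 bp] := bc_is_bary p.
Qed.

Lemma bc_comb (l : {ffun V -> R}) : (forall v, v \notin T -> l v = 0) ->
  \sum_v l v = 1 -> bc (\sum_v l v *: x v) = l.
Proof. by move=> l0 l1; apply/esym/(@bary_bc T). Qed.

Lemma bc_vertex v : v \in T -> bc (x v) = [ffun w => (w == v)%:R].
Proof.
move=> vT; rewrite -[RHS]bc_comb; first last.
- by rewrite (bigD1 v) //= ffunE eqxx big1 ?addr0 // => w wv; rewrite ffunE (negPf wv).
- by move=> w wT; rewrite ffunE; case: eqP => // wv; rewrite wv vT in wT.
congr bc; rewrite (bigD1 v) //= ffunE eqxx scale1r big1 ?addr0 // => w wv.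
by rewrite ffunE (negPf wv) scale0r.
Qed.

Lemma dl_notin h v : v \notin T -> dl h v = 0.
Proof.
(* A scalar is read off as the value at 0 of its constant polynomial; the next lemmas differentiate
   the identities defining the coordinates in the same way. *)
move=> vT; rewrite -[LHS](evC _ (0 : E)) -(bary_dirD hL) (bary_notin hL) //.
by rewrite dirD0 ev0.
Qed.

Lemma dl_sum0 h : \sum_v dl h v = 0.
Proof.
rewrite sum_in_T => [|v]; last exact: dl_notin.
under eq_bigr do rewrite -[dl _ _](evC _ (0 : E)) -(bary_dirD hL).
by rewrite -ev_sum -dirD_sum (bary_sum1 hL) -mpolyC1 dirDC ev0.
Qed.

Lemma dl_sumx h : \sum_v dl h v *: x v = h.
Proof.
rewrite sum_in_T => [|v vT]; last by rewrite dl_notin // scale0r.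
apply/rowP => i; rewrite summxE -[RHS](evC _ (0 : E)) -dirD_pX -(bary_sumx hL).
rewrite dirD_sum ev_sum; apply: eq_bigr => v _.
by rewrite dirDZ (bary_dirD hL) evZ evC mxE mulrC.
Qed.

Lemma dlZ c h v : dl (c *: h) v = c * dl h v.
Proof.
rewrite -[LHS](evC _ (0 : E)) -(bary_dirD hL) dirD_scalev evZ (bary_dirD hL).
by rewrite evC.
Qed.

Lemma dlD h h' v : dl (h + h') v = dl h v + dl h' v.
Proof.
rewrite -[LHS](evC _ (0 : E)) -(bary_dirD hL) dirD_addv evD !(bary_dirD hL).
by rewrite !evC.
Qed.

End Coordinates.

End BarycentricPolynomials.

(** * Bernstein monomials and spans constrained by distances to faces *)

Section Monomials.
Context {R : realType} {V : finType}.
Notation E := ('rV[R]_3).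
Notation poly3 := (mpoly 3 R).
Variables (x : V -> E) (T : {set V}) (L : V -> poly3) (dl : E -> V -> R).
Hypotheses (hT : tetrahedron x T) (hL : bary_polys x T L dl).
Implicit Types (g h : {set V}) (a b : V -> nat) (P Q : poly3) (r : {set V} -> int).

Definition mono a : poly3 := \prod_(v in T) L v ^+ a v.

(** Truncation at [a w = 0] is harmless: in the derivative of a monomial this term carries the
    coefficient [a w]. *)
Definition decr (w : V) a : V -> nat := fun v => (a v - (v == w))%N.

Lemma eq_mono a b : {in T, a =1 b} -> mono a = mono b.
Proof. by move=> ab; apply: eq_bigr => v /ab ->. Qed.

Lemma monoD a b : mono a * mono b = mono (fun v => a v + b v)%N.
Proof. by rewrite -big_split; apply: eq_bigr => v _; rewrite exprD. Qed.

Lemma dirD_Lpow u v n :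
  dirD u (L v ^+ n) = (n%:R * dl u v) *: L v ^+ n.-1.
Proof.
elim: n => [|[|n] IH]; first by rewrite expr0 -mpolyC1 dirDC mul0r scale0r.
  by rewrite expr1 (bary_dirD hL) expr0 mul1r -alg_mpolyC.
rewrite exprS dirDM IH (bary_dirD hL) /= -scalerAr -exprS mul_mpolyC -scalerDl.
by rewrite -[in RHS]natr1 mulrDl mul1r addrC.
Qed.

Lemma dirD_mono u a : dirD u (mono a) =
  \sum_(w in T) ((a w)%:R * dl u w) *: mono (decr w a).
Proof.
rewrite /mono -big_enum -[RHS]big_enum /=.
under [RHS]eq_bigr do rewrite -big_enum.
elim: (enum T) (enum_uniq T) => [|v s IH] /=; first by rewrite !big_nil -mpolyC1 dirDC.
case/andP=> vs us; rewrite !big_cons dirDM IH // dirD_Lpow; congr (_ + _).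
  rewrite -scalerAl (_ : decr v a v = (a v).-1); last by rewrite /decr eqxx subn1.
  congr (_ *: (_ * _)).
  rewrite big_seq [RHS]big_seq; apply: eq_bigr => w ws.
  by rewrite /decr (negPf (memPn vs _ ws)) subn0.
rewrite big_distrr /= big_seq [RHS]big_seq; apply: eq_bigr => w ws.
rewrite big_cons -scalerAr (_ : decr w a v = a v) // /decr.
by rewrite eq_sym (negPf (memPn vs _ ws)) subn0.
Qed.

Definition dist a g : nat := \sum_(v in T :\: g) a v.

(** The bounds form a function on all faces, so that one entry can be changed at a time. The value
    -1 imposes nothing, while any bound >= 0 at T itself admits no exponent. *)
Definition adm (d : nat) r a : bool :=
  (\sum_(v in T) a v == d)%N &&
  [forall g : {set V}, (g \subset T) && (g != finset.set0) ==> (r g < (dist a g)%:Z)].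

Lemma admP d r a : reflect ((\sum_(v in T) a v = d)%N /\
   forall g, g \subset T -> g != finset.set0 -> r g < (dist a g)%:Z) (adm d r a).
Proof.
apply: (iffP andP) => -[/eqP sa ra]; split => //.
  by move=> g gT g0; move/forallP/(_ g): ra; rewrite gT g0.
by apply/forallP => g; apply/implyP => /andP[gT g0]; apply: ra.
Qed.

Inductive spn (d : nat) r : poly3 -> Prop :=
| spn_nil : spn d r 0
| spn_cons c a P of adm d r a & spn d r P : spn d r (c *: mono a + P).

Lemma spn_mono d r c a : adm d r a -> spn d r (c *: mono a).
Proof. by move=> da; rewrite -[X in spn _ _ X]addr0; apply: spn_cons => //; exact: spn_nil. Qed.

Lemma spnD d r P Q : spn d r P -> spn d r Q -> spn d r (P + Q).
Proof.
by move=> dP dQ; elim: dP => [|c a P' da _ IH]; rewrite ?add0r // -addrA; apply: spn_cons.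
Qed.

Lemma spnZ d r c P : spn d r P -> spn d r (c *: P).
Proof.
elim=> [|c' a P' da _ IH]; first by rewrite scaler0; exact: spn_nil.
by rewrite scalerDr scalerA; apply: spn_cons.
Qed.

Lemma spn_sum d r (I : Type) (s : seq I) (B : pred I) (F : I -> poly3) :
  (forall i, B i -> spn d r (F i)) -> spn d r (\sum_(i <- s | B i) F i).
Proof. by move=> dF; apply: big_ind => //; [exact: spn_nil|exact: spnD]. Qed.

Lemma spn_sub d r r' P : (forall a, adm d r a -> adm d r' a) -> spn d r P -> spn d r' P.
Proof.
by move=> rr'; elim=> [|c a P' /rr' da _ IH]; [exact: spn_nil|exact: spn_cons].
Qed.

Lemma spn_mul d e P Q : spn d (fun=> -1) P -> spn e (fun=> -1) Q ->
  spn (d + e) (fun=> -1) (P * Q).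
Proof.
move=> dP eQ; elim: dP => [|c a P' /admP[da _] _ IH]; first by rewrite mul0r; exact: spn_nil.
rewrite mulrDl; apply: spnD => //; rewrite -scalerAl; apply: spnZ.
elim: eQ => [|c' b Q' /admP[eb _] _ IH']; first by rewrite mulr0; exact: spn_nil.
rewrite mulrDr -scalerAr monoD; apply: spn_cons => //.
by apply/admP; split=> //; rewrite big_split da eb.
Qed.

Lemma spn1_L v : v \in T -> spn 1 (fun=> -1) (L v).
Proof.
move=> vT; rewrite [X in spn _ _ X](_ : _ = 1 *: mono (fun w => w == v)).
  apply: spn_mono; apply/admP; split => //.
  by rewrite (bigD1 v) //= eqxx big1 // => w /andP[_ /negPf ->].
rewrite scale1r /mono (bigD1 v) //= eqxx expr1 big1 ?mulr1 // => w /andP[_ /negPf ->].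
by rewrite expr0.
Qed.

Lemma spn1_1 : spn 1 (fun=> -1) 1.
Proof. by rewrite -(bary_sum1 hL); apply: spn_sum => v; exact: spn1_L. Qed.

Lemma spn1_pX i : spn 1 (fun=> -1) (pX i).
Proof.
by rewrite -(bary_sumx hL); apply: spn_sum => v vT; apply: spnZ; exact: spn1_L.
Qed.

Lemma spn0_1 : spn 0 (fun=> -1) 1.
Proof.
rewrite [X in spn _ _ X](_ : _ = 1 *: mono (fun=> 0%N)).
  by apply: spn_mono; apply/admP; split => //; rewrite big1.
by rewrite scale1r /mono big1.
Qed.

Lemma spn_pow d P n : spn d (fun=> -1) P -> spn (n * d) (fun=> -1) (P ^+ n).
Proof.
by move=> dP; elim: n => [|n IH]; [exact: spn0_1|rewrite exprS mulSn; exact: spn_mul].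
Qed.

(* Homogenisation: multiply by powers of [1 = \sum_v L v]. *)
Lemma bernstein d P : deg_le d%:Z P -> spn d (fun=> -1) P.
Proof.
move=> dP; rewrite [P]mpolyE big_seq; apply: spn_sum => m mP; apply: spnZ.
have md : (mdeg m <= d)%N by have := dP m mP.
rewrite -(subnKC md) -[mpolyX _ _]mulr1; apply: spn_mul; last first.
  by have := spn_pow (d - mdeg m) spn1_1; rewrite muln1 expr1n.
rewrite mpolyXE_id mdegE; apply: (big_ind2 (fun P n => spn n (fun=> -1) P)).
- exact: spn0_1.
- by move=> P1 n1 P2 n2; exact: spn_mul.
- by move=> i _; have := spn_pow (m i) (spn1_pX i); rewrite muln1.
Qed.

Lemma sum_decr w a (S : {set V}) : w \in S -> (0 < a w)%N ->
  (\sum_(v in S) decr w a v).+1 = \sum_(v in S) a v.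
Proof.
move=> wS aw; rewrite (bigD1 w) //= [in RHS](bigD1 w) //= /decr eqxx.
rewrite -addSn subn1 prednK //; congr addn.
by apply: eq_bigr => v /andP[_ /negPf ->]; rewrite subn0.
Qed.

Lemma sum_decr_notin w a (S : {set V}) : w \notin S ->
  \sum_(v in S) decr w a v = \sum_(v in S) a v.
Proof.
by move=> wS; apply: eq_bigr => v vS; rewrite /decr (negPf (memPn wS _ vS)) subn0.
Qed.

Lemma dist_decr w a g : w \in T -> (0 < a w)%N ->
  (dist (decr w a) g + (w \notin g))%N = dist a g.
Proof.
move=> wT aw; rewrite /dist; have [wg|wg] := boolP (w \in g).
  by rewrite addn0 sum_decr_notin // inE wg //.
by rewrite addn1 sum_decr // inE wg //.
Qed.

Lemma adm_decr d r w a : w \in T -> (0 < a w)%N -> adm d r a ->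
  adm d.-1 (fun g => r g - 1) (decr w a).
Proof.
move=> wT aw /admP[da ra]; apply/admP; split; first by rewrite -da -(@sum_decr w a T).
move=> g gT g0; have := ra g gT g0; rewrite -(dist_decr g wT aw).
by case: (w \notin g) => /=; lia.
Qed.

(** Lowering one exponent lowers the degree by one and each distance by at most one. For d = 0 all
    exponents on T vanish and so does the derivative, whence the truncated predecessor does no
    harm. *)
Lemma spn_dirD d r u P : spn d r P -> spn d.-1 (fun g => r g - 1) (dirD u P).
Proof.
elim=> [|c a P' da _ IH]; first by rewrite dirD0; exact: spn_nil.
rewrite dirDD dirDZ; apply: spnD => //; apply: spnZ; rewrite dirD_mono.
apply: spn_sum => w wT; have [a0|aw] := posnP (a w).
  by rewrite a0 mul0r scale0r; exact: spn_nil.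
by apply: spn_mono; exact: adm_decr.
Qed.

Lemma spn_itD d r u j P : spn d r P -> spn (d - j) (fun g => r g - j%:Z) (itD u j P).
Proof.
move=> dP; elim: j => [|j IH] /=.
  rewrite subn0; apply: spn_sub dP => a; rewrite (_ : (fun _ => _) = r) //.
  by apply/funext => g; rewrite subr0.
rewrite subnS; apply: spn_sub (spn_dirD u IH) => a.
suff -> : (fun g => r g - j.+1%:Z) = (fun g => r g - j%:Z - 1) by [].
by apply/funext => g; lia.
Qed.

Definition nmap {d} (a : {ffun V -> 'I_d.+1}) : V -> nat := fun v => a v.

Lemma adm_eq d r a b : {in T, a =1 b} -> adm d r a = adm d r b.
Proof.
move=> ab; rewrite /adm (eq_bigr _ ab); congr (_ && _).
apply: eq_forallb => g; rewrite /dist (eq_bigr b) // => v.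
by rewrite inE => /andP[_ /ab].
Qed.

(** Moves exponents into a finite type. Nothing is lost on T, where the entries of an exponent of
    degree d are at most d; the zeros outside T make the representative unique. *)
Definition trunc d a : {ffun V -> 'I_d.+1} := [ffun v => if v \in T then inord (a v) else ord0].

Lemma truncE d r a : adm d r a -> {in T, nmap (trunc d a) =1 a}.
Proof.
move=> /admP[sa _] v vT; rewrite /nmap ffunE vT inordK // ltnS -sa.
by rewrite (bigD1 v) //= leq_addr.
Qed.

Lemma mem_index0 d g (a : {ffun V -> 'I_d.+1}) : a \in bubble_index g d [::] =
  [forall v, (v \notin g) ==> (a v == 0%N :> nat)] && (\sum_(v in g) a v == d)%N.
Proof. by rewrite inE; congr (_ && _); rewrite -[RHS]andbT; congr (_ && _); apply/forallP; case. Qed.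

Lemma trunc_index0 d r a : adm d r a -> trunc d a \in bubble_index T d [::].
Proof.
move=> da; rewrite mem_index0; apply/andP; split.
  by apply/forallP => v; apply/implyP => /negPf vT; rewrite ffunE vT.
by have /admP[sa _] := da; rewrite -[X in _ == X]sa; apply/eqP/eq_bigr => v; exact: (truncE da).
Qed.

Lemma spn_coefs d r P : spn d r P -> exists c : {ffun V -> 'I_d.+1} -> R,
  P = \sum_(a in bubble_index T d [::] | adm d r (nmap a)) c a *: mono (nmap a).
Proof.
elim=> [|c a P' da _ [c' ->]].
  by exists (fun=> 0); rewrite big1 // => a _; rewrite scale0r.
(* Repeated monomials of the inductive span are merged by adding the new coefficient at its
   index. *)
exists (fun e : {ffun V -> 'I_d.+1} => c *+ (e == trunc d a) + c' e).
under [RHS]eq_bigr do rewrite scalerDl; rewrite big_split; congr (_ + _).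
rewrite (bigD1 (trunc d a)) /=; last by rewrite (trunc_index0 da) (adm_eq _ _ (truncE da)).
rewrite eqxx mulr1n [X in _ + X]big1 ?addr0 ?(eq_mono (truncE da)) // => b /andP[_ /negPf ->].
by rewrite mulr0n scale0r.
Qed.

End Monomials.

(* Distinct monomials are distinct multiplicative characters of the positive
   orthant, hence independent by Artin's argument. *)
Lemma monomials_free (R : realType) (V : finType) (d : nat)
    (A : {set {ffun V -> 'I_d.+1}}) (c : {ffun V -> 'I_d.+1} -> R) :
  (forall z : V -> R, (forall v, 0 < z v) ->
     \sum_(a in A) c a * \prod_v z v ^+ a v = 0) ->
  forall a, a \in A -> c a = 0.
Proof.
have [n] := ubnP #|A|; elim: n A c => // n IH A c cA c0 a aA.
(* Once all other coefficients vanish, evaluation at (1, ..., 1) gives c a = 0. *)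
suff cb b : b \in A -> b != a -> c b = 0.
  have := c0 (fun=> 1) (fun=> ltr01); rewrite (bigD1 a) //= [X in _ + X]big1.
    by rewrite addr0 big1 ?mulr1 // => v _; rewrite expr1n.
  by move=> b /andP[bA ba]; rewrite cb // mul0r.
move=> bA ba; have [v bv] : exists v, b v != a v.
  apply/existsP; apply: contraNT ba; rewrite negb_exists => /forallP ba.
  by apply/eqP/ffunP => v; have := ba v; rewrite negbK => /eqP.
(* Scaling by [y] doubles the coordinate in which a and b differ, so the two characters take
   different values 2 ^ a v and 2 ^ b v there. *)
pose y w : R := if w == v then 2 else 1.
have y0 w : 0 < y w by rewrite /y; case: eqP.
have yE e : \prod_w y w ^+ (e w : 'I_d.+1) = 2 ^+ e v.
  rewrite (bigD1 v) //= big1 ?mulr1 => [|w /negPf wv]; rewrite /y ?eqxx //.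
  by rewrite wv expr1n.
(* The relation at y z minus 2 ^ a v times the relation at z: the term of a cancels, and the smaller
   set is covered by induction. *)
have := IH (A :\ a) (fun e => c e * (2 ^+ e v - 2 ^+ a v)) _ _ b.
rewrite !inE ba bA => /(_ _ _ isT)/eqP; rewrite mulf_eq0 subr_eq0 => hb.
suff /negPf ne : (2 : R) ^+ b v != 2 ^+ a v.
  apply/eqP; have := hb _ _; rewrite ne orbF; apply.
    by move: cA; rewrite (cardsD1 a A) aA add1n ltnS.
  move=> z z0; have := c0 (fun w => y w * z w) (fun w => mulr_gt0 (y0 w) (z0 w)).
  have := c0 z z0; move/(congr1 (fun t => - 2 ^+ a v * t)); rewrite mulr0 mulr_sumr => e1.
  under eq_bigr do under eq_bigr do rewrite exprMn.
  under eq_bigr do rewrite big_split yE.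
  move=> e2; have := congr2 +%R e1 e2; rewrite addr0 -big_split (bigD1 a) //= => e3.
  rewrite -[RHS]e3 [X in X + _](_ : _ = 0) ?add0r; last by ring.
  apply: eq_big => [e|e _]; first by rewrite !inE andbC.
  by ring.
apply: contra bv => /eqP e; apply/eqP/val_inj.
by apply: ieexprIn e; rewrite // ?(eqr_nat _ 2 1) ?ltr0n.
Qed.

(** * Reading off Bernstein coefficients from derivatives on a face *)

Section VanishingOrder.
Context {R : realType} {V : finType}.
Notation E := ('rV[R]_3).
Notation poly3 := (mpoly 3 R).
Variables (x : V -> E) (T : {set V}) (L : V -> poly3) (dl : E -> V -> R).
Hypotheses (hT : tetrahedron x T) (hL : bary_polys x T L dl).
Implicit Types (g h : {set V}) (P Q : poly3) (r : {set V} -> int) (u p : E).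

Lemma itD_sum u j (I : Type) (s : seq I) (B : pred I) (F : I -> poly3) :
  itD u j (\sum_(i <- s | B i) F i) = \sum_(i <- s | B i) itD u j (F i).
Proof. by elim: j => //= j ->; rewrite dirD_sum. Qed.

Lemma itDZ u j c P : itD u j (c *: P) = c *: itD u j P.
Proof. by elim: j => //= j ->; rewrite dirDZ. Qed.

Lemma itDB u j P Q : itD u j (P - Q) = itD u j P - itD u j Q.
Proof. by elim: j => //= j ->; rewrite dirDB. Qed.

Lemma itDSr u j P : itD u j.+1 P = itD u j (dirD u P).
Proof. exact: iterSr. Qed.

Definition on_plane g p := forall v, v \notin g -> bc L p v = 0.

Lemma ev_mono (a : V -> nat) p : ev (mono T L a) p = \prod_(v in T) bc L p v ^+ a v.
Proof. by rewrite ev_prod; apply: eq_bigr => v _; rewrite evX ffunE. Qed.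

Lemma ev_mono_plane g (a : V -> nat) p : g \subset T -> on_plane g p ->
  ev (mono T L a) p = (\prod_(v in g) bc L p v ^+ a v) *+ (dist T a g == 0%N).
Proof.
move=> gT gp; rewrite ev_mono (big_setID g) /= (finset.setIidPr gT).
have [/eqP|] := eqVneq (dist T a g) 0%N.
  rewrite sum_nat_eq0 => /forall_inP a0; rewrite mulr1n [X in _ * X]big1 ?mulr1 // => v vg.
  by rewrite (eqP (a0 v vg)) expr0.
rewrite sum_nat_eq0 negb_forall_in => /exists_inP[v vg av].
rewrite mulr0n (bigD1 v vg) /= gp; last by move: vg; rewrite inE => /andP[].
by rewrite expr0n (negPf av) mul0r mulr0.
Qed.

(** On the plane of g every factor lambda_w with w outside g vanishes, so each of the j derivatives
    must remove one of them; the monomial survives only if there are exactly j, and the orders of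
    removal account for j!. *)
Lemma ev_itD_mono g u j (a : V -> nat) p : g \subset T -> on_plane g p -> (j <= dist T a g)%N ->
  ev (itD u j (mono T L a)) p =
  (j`!%:R * \prod_(v in g) bc L p v ^+ a v * \prod_(v in T :\: g) dl u v ^+ a v)
  *+ (dist T a g == j).
Proof.
move=> gT gp; elim: j a => [|j IH] a ja.
  rewrite (ev_mono_plane _ gT gp) fact0 mul1r.
  case: eqP => // a0; rewrite !mulr1n [X in _ = _ * X]big1 ?mulr1 // => v vg.
  move/eqP: a0; rewrite sum_nat_eq0 => /forall_inP/(_ v vg)/eqP ->.
  by rewrite expr0.
rewrite itDSr (dirD_mono hL) itD_sum ev_sum.
(* Lowering an exponent inside g leaves the distance above j, so that term vanishes; outside g, the
   factor [dl u w] missing from the product comes from the derivative just taken. *)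
have step w : w \in T -> ev (itD u j (((a w)%:R * dl u w) *: mono T L (decr w a))) p =
    ((w \notin g) * a w)%N%:R * ((j`!%:R * \prod_(v in g) bc L p v ^+ a v *
     \prod_(v in T :\: g) dl u v ^+ a v) *+ (dist T a g == j.+1)).
  move=> wT; rewrite itDZ evZ; have [a0|aw] := posnP (a w).
    by rewrite a0 muln0 !mul0r.
  have := dist_decr g wT aw; have [wg|wg] /= := boolP (w \in g).
    rewrite addn0 mul0n mul0r => dw.
    by rewrite IH dw ?(ltnW ja) // (gtn_eqF ja) mulr0n mulr0.
  rewrite addn1 mul1n => dw; rewrite IH; last by rewrite -ltnS dw.
  rewrite -dw eqSS; case: eqP => _; rewrite ?mulr0n ?mulr0 // !mulr1n.
  have -> : \prod_(v in g) bc L p v ^+ decr w a v = \prod_(v in g) bc L p v ^+ a v.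
    by apply: eq_bigr => v vg; rewrite /decr (negPf (memPn wg _ vg)) subn0.
  have wTg : w \in T :\: g by rewrite inE wg.
  rewrite (bigD1 w wTg) [in RHS](bigD1 w wTg) /=.
  have -> : \prod_(v in T :\: g | v != w) dl u v ^+ decr w a v =
            \prod_(v in T :\: g | v != w) dl u v ^+ a v.
    by apply: eq_bigr => v /andP[_ /negPf vw]; rewrite /decr vw subn0.
  rewrite (_ : decr w a w = (a w).-1); last by rewrite /decr eqxx subn1.
  by rewrite -[in RHS](prednK aw) [in RHS]exprS prednK //; ring.
rewrite (eq_bigr _ step) -mulr_suml -natr_sum.
(* The multiplicities outside g add up to j + 1, which completes the factorial. *)
have -> : (\sum_(w in T) (w \notin g) * a w)%N = dist T a g.
  rewrite /dist (big_setID g) /= big1 ?add0n => [|w].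
    by apply: eq_bigr => w; rewrite inE => /andP[-> _]; rewrite mul1n.
  by rewrite inE => /andP[_ ->].
case: eqP => [->|_]; last by rewrite !mulr0n mulr0.
by rewrite !mulr1n factS natrM; ring.
Qed.

Definition relint g p := on_plane g p /\ forall v, v \in g -> 0 < bc L p v.

(** Barycentric coordinates only range over a simplex; normalising an arbitrary positive vector
    makes the whole orthant available to homogeneous expressions. *)
Lemma relint_ratios g (z : V -> R) : g \subset T -> g != finset.set0 -> (forall v, 0 < z v) ->
  0 < \sum_(v in g) z v /\
  exists2 p, relint g p & forall v, v \in g -> bc L p v = z v / \sum_(v in g) z v.
Proof.
move=> gT g0 z0; set s := \sum_(v in g) z v.
have s0 : 0 < s.
  case/finset.set0Pn: g0 => v vg; rewrite /s (bigD1 v vg) ltr_pwDl // sumr_ge0 // => w _.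
  exact: ltW.
pose l : {ffun V -> R} := [ffun v => if v \in g then z v / s else 0].
have lg v : v \notin g -> l v = 0 by move=> /negPf vg; rewrite ffunE vg.
have pl : bc L (\sum_v l v *: x v) = l.
  apply: (bc_comb hT hL) => [v vT|].
    by apply: lg; exact: contra (fintype.subsetP gT v) vT.
  rewrite (bigID (mem g)) /= [X in _ + X]big1 ?addr0 => [|v]; last exact: lg.
  under eq_bigr => v vg do rewrite ffunE vg.
  by rewrite -mulr_suml divff // gt_eqF.
split=> //; exists (\sum_v l v *: x v) => [|v vg]; last by rewrite pl ffunE vg.
by split=> [v|v vg]; rewrite pl; [exact: lg|rewrite ffunE vg divr_gt0].
Qed.

Definition upd r g (s : int) : {set V} -> int :=
  fun h => if h == g then Num.max (r g) s else r h.

(** Directions in [N] represent every vector modulo the tangent space of g, expressed through the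
    derivatives of the coordinates opposite to g. *)
Definition transversal_dirs g (N : E -> Prop) :=
  forall y : V -> R, exists2 u, N u & forall w, w \in T :\: g -> dl u w = y w.

(** All exponents have distance at least j from g, so the j-th derivative sees only those at
    distance exactly j. As p and u vary it becomes, up to a nonzero factor, their generating
    polynomial on the positive orthant. *)
Lemma spn_upd1 g N d r j P : g \subset T -> g != finset.set0 -> transversal_dirs g N ->
  j%:Z <= r g + 1 -> spn T L d r P ->
  (forall u p, N u -> relint g p -> ev (itD u j P) p = 0) ->
  spn T L d (upd r g j%:Z) P.
Proof.
move=> gT g0 hN jr /spn_coefs[c Pc] P0.
pose A := [set a in bubble_index T d [::] | adm T d r (nmap a) && (dist T (nmap a) g == j)].
have A0 : forall a, a \in A -> c a = 0.
  apply: monomials_free => z z0.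
  have [s0 [p rp pl]] := relint_ratios gT g0 z0; have gp := rp.1.
  set s := \sum_(v in g) z v in s0 pl.
  (* The same [z] prescribes the point of g through the vertices in g and the direction through the
     vertices outside. *)
  have [u Nu uz] := hN z.
  have := P0 u p Nu rp; rewrite Pc itD_sum ev_sum (bigID (mem A)) /=.
  rewrite [X in _ + X]big1 ?addr0 => [|a /andP[/andP[aT da] aA]]; last first.
    have /admP[_ /(_ g gT g0) ra] := da; rewrite itDZ evZ (ev_itD_mono _ gT gp); last by lia.
    by move: aA; rewrite inE aT da /= => /negPf ->; rewrite mulr0n mulr0.
  (* Every exponent in [A] has total d - j on g, so normalising the coordinates contributes the
     common factor s ^ -(d - j). *)
  have eT a : a \in A -> ev (itD u j (c a *: mono T L (nmap a))) p =
      (j`!%:R / s ^+ (d - j)) * (c a * \prod_v z v ^+ a v).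
    rewrite inE => /andP[aT /andP[/admP[da _] /eqP ja]].
    rewrite itDZ evZ (ev_itD_mono _ gT gp) ja ?leqnn // eqxx mulr1n.
    have -> : \prod_(v in g) bc L p v ^+ nmap a v =
        (\prod_(v in g) z v ^+ a v) / s ^+ (d - j).
      have -> : (d - j = \sum_(v in g) nmap a v)%N.
        move: da; rewrite (big_setID g) /= (finset.setIidPr gT) -[X in (_ + X)%N]/(dist T _ g) ja.
        by lia.
      rewrite -prodrXr -prodf_div; apply: eq_bigr => v vg.
      by rewrite pl // expr_div_n.
    have -> : \prod_(v in T :\: g) dl u v ^+ nmap a v = \prod_(v in T :\: g) z v ^+ a v.
      by apply: eq_bigr => v vg; rewrite uz.
    have -> : \prod_v z v ^+ a v = (\prod_(v in g) z v ^+ a v) * (\prod_(v in T :\: g) z v ^+ a v).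
      rewrite (bigID (mem T)) /= [X in _ * X]big1 ?mulr1 => [|v vT].
        by rewrite (big_setID g) /= (finset.setIidPr gT).
      by move: aT; rewrite mem_index0 => /andP[/forallP/(_ v)]; rewrite vT => /eqP ->.
    by ring.
  rewrite (eq_bigl (fun a => a \in A)) => [|a]; last first.
    by apply: andb_idl; rewrite inE => /andP[-> /andP[-> _]].
  rewrite (eq_bigr _ eT) -mulr_sumr => /eqP; rewrite mulf_eq0 mulf_eq0 invr_eq0.
  rewrite expf_eq0 (gt_eqF s0) andbF orbF pnatr_eq0 (gtn_eqF (fact_gt0 _)) => /eqP sA.
  by rewrite -[RHS]sA.
rewrite Pc; apply: spn_sum => a /andP[aT da].
have [aA|aA] := boolP (a \in A); first by rewrite A0 // scale0r; exact: spn_nil.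
apply: spn_mono; have /admP[sa ra] := da; apply/admP; split => // h hT' h0.
rewrite /upd; case: eqP => [->|_]; last exact: ra.
have := ra g gT g0; move: aA; rewrite inE aT da /=; lia.
Qed.

Lemma spn_upd g N d r (s : int) P : g \subset T -> g != finset.set0 ->
  transversal_dirs g N -> -1 <= r g -> spn T L d r P ->
  (forall (j : nat) u p, j%:Z <= s -> N u -> relint g p -> ev (itD u j P) p = 0) ->
  spn T L d (upd r g s) P.
Proof.
move=> gT g0 hN rg dP P0.
have upd_low (s' : int) : s' <= r g -> upd r g s' = r.
  by move=> sr; apply/funext => h; rewrite /upd; case: eqP => // ->; apply/max_idPl.
(* After n orders of derivatives the bound is n - 1; the start n = 0 is the trivial bound -1, and n
   = s + 1 is the goal. *)
suff H n : n%:Z <= s + 1 -> spn T L d (upd r g (n%:Z - 1)) P.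
  have [s0|s0] := leP s (r g); first by rewrite upd_low.
  have -> : s = (absz (s + 1))%:Z - 1 by lia.
  by apply: H; lia.
elim: n => [|n IH] ns; first by rewrite upd_low // sub0r.
have /IH {}IH : n%:Z <= s + 1 by lia.
have -> : upd r g (n.+1%:Z - 1) = upd (upd r g (n%:Z - 1)) g n%:Z.
  by apply/funext => h; rewrite /upd eqxx; case: eqP => // _; lia.
apply: (spn_upd1 gT g0 hN) => //; first by rewrite /upd eqxx; lia.
by move=> u p Nu rp; apply: P0 => //; lia.
Qed.

End VanishingOrder.

(** * Normal vectors are transversal; general directional derivatives from the given ones *)

Section NormalDirections.
Context {R : realType} {V : finType}.
Notation E := ('rV[R]_3).
Notation poly3 := (mpoly 3 R).
Variables (x : V -> E) (T : {set V}) (L : V -> poly3) (dl : E -> V -> R).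
Hypotheses (hT : tetrahedron x T) (hL : bary_polys x T L dl).
Implicit Types (g h : {set V}) (P Q : poly3) (u p : E).

Lemma dotE (a b : E) : dot a b = \sum_i a 0 i * b 0 i.
Proof. by rewrite /dot mxE; apply: eq_bigr => i _; rewrite mxE. Qed.

Lemma dot_eq0 (a : E) : dot a a = 0 -> a = 0.
Proof.
rewrite dotE => /eqP; rewrite psumr_eq0 => [/allP a0|i _]; last by rewrite -expr2 sqr_ge0.
apply/rowP => i; rewrite mxE; apply/eqP.
by have := a0 i (mem_index_enum _); rewrite mulf_eq0 orbb.
Qed.

Lemma dotC (a b : E) : dot a b = dot b a.
Proof. by rewrite !dotE; apply: eq_bigr => i _; rewrite mulrC. Qed.

Lemma dotDr (a b c : E) : dot a (b + c) = dot a b + dot a c.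
Proof. by rewrite !dotE -big_split; apply: eq_bigr => i _; rewrite mxE mulrDr. Qed.

Lemma dotZr (a b : E) (c : R) : dot a (c *: b) = c * dot a b.
Proof. by rewrite !dotE mulr_sumr; apply: eq_bigr => i _; rewrite mxE mulrCA. Qed.

Lemma dot_sumr (a : E) (I : Type) (s : seq I) (B : pred I) (F : I -> E) :
  dot a (\sum_(i <- s | B i) F i) = \sum_(i <- s | B i) dot a (F i).
Proof.
apply: (big_morph (dot a)) => [b c|]; first exact: dotDr.
by rewrite dotE big1 // => i _; rewrite mxE mulr0.
Qed.

Lemma dl_expand u w : dl u w = \sum_(i < 3) u 0 i * dl (e_ i) w.
Proof.
rewrite {1}(row_sum_delta u); elim/big_rec2: _ => [|i a b _ <-].
  by rewrite -[X in dl X](scale0r 0) (dlZ hL) mul0r.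
by rewrite (dlD hL) (dlZ hL).
Qed.

(* A normal direction tangent to [g] is orthogonal to itself. *)
Lemma normal_tangent0 g u : g != finset.set0 -> normal_to x g u ->
  (forall w, w \in T :\: g -> dl u w = 0) -> u = 0.
Proof.
move=> /finset.set0Pn[v0 v0g] ng tu; apply: dot_eq0.
(* Since the coefficients [dl u v] sum to 0, u is a combination of the edge vectors of g, to which
   it is orthogonal. *)
rewrite -{2}(dl_sumx hL u) (eq_bigr (fun v => dl u v *: (x v - x v0) + dl u v *: x v0)).
  rewrite big_split /= -scaler_suml (dl_sum0 hL) scale0r addr0 dot_sumr big1 // => v _.
  rewrite dotZr dotC; have [vg|vg] := boolP (v \in g); first by rewrite ng ?mulr0.
  have [vT|vT] := boolP (v \in T); first by rewrite tu ?mul0r // inE vg.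
  by rewrite (dl_notin hL) ?mul0r.
by move=> v _; rewrite scalerBr subrK.
Qed.

(** The map from normal vectors to the derivatives of the opposite coordinates is injective because
    normal and tangent directions meet in 0; as c is the codimension of g, it is also surjective. *)
Lemma normals_transversal g (c : nat) (N : 'M[R]_(c, 3)) : g != finset.set0 ->
  #|T :\: g| = c -> row_free N -> (forall y : 'rV_c, normal_to x g (y *m N)) ->
  transversal_dirs T dl g (fun u => exists y : 'rV_c, u = y *m N).
Proof.
move=> g0 cN fN nN.
pose D : 'M[R]_(3, #|T :\: g|) := \matrix_(i, j) dl (e_ i) (enum_val j).
have DE u j : (u *m D) 0 j = dl u (enum_val j).
  by rewrite mxE dl_expand; apply: eq_bigr => i _; rewrite mxE.
have fA : row_free (N *m D).
  rewrite -kermx_eq0; apply/eqP/row_matrixP => i; rewrite row0.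
  set y := row i _; have : y *m (N *m D) = 0 by rewrite /y -row_mul mulmx_ker row0.
  rewrite mulmxA => /rowP yND.
  have yN : y *m N = 0.
    apply: (normal_tangent0 g0 (nN y)) => w wg.
    by rewrite -(enum_rankK_in wg wg) -DE yND mxE.
  by apply: (row_free_inj fN); rewrite yN mul0mx.
move=> y; pose z : 'rV[R]_(#|T :\: g|) := \row_j y (enum_val j).
have fullA : row_full (N *m D) by rewrite /row_full (eqP fA) cN.
have /submxP[t zt] := submx_full z fullA.
exists (t *m N) => [|w wg]; first by exists t.
by rewrite -(enum_rankK_in wg wg) -DE -mulmxA -zt mxE.
Qed.

Lemma normal_toD g u u' : normal_to x g u -> normal_to x g u' -> normal_to x g (u + u').
Proof. by move=> nu nu' a b ag bg; rewrite dotDr nu ?nu' ?addr0. Qed.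

Lemma normal_toZ g c u : normal_to x g u -> normal_to x g (c *: u).
Proof. by move=> nu a b ag bg; rewrite dotZr nu ?mulr0. Qed.

Lemma card_T : #|T| = 4%N. Proof. by case: hT. Qed.

Lemma card_TD g n : g \subset T -> #|g| = n -> #|T :\: g| = (4 - n)%N.
Proof. by move=> gT gn; rewrite cardsD (finset.setIidPr gT) gn card_T. Qed.

Lemma card_neq0 g n : #|g| = n.+1 -> g != finset.set0.
Proof. by move=> gn; rewrite -card_gt0 gn. Qed.

Lemma vertex_transversal v : v \in T -> transversal_dirs T dl [set v]%SET (fun=> True).
Proof.
move=> vT y; have [|||z|u _ uy] := @normals_transversal [set v]%SET 3 1%:M _ _ _ _ y.
- exact: (card_neq0 (cards1 v)).
- by rewrite (card_TD _ (cards1 v)) // finset.sub1set.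
- by rewrite row_free_unit unitmx1.
- move=> a b; rewrite !inE => /eqP -> /eqP ->.
  by rewrite subrr -(scale0r (0 : E)) dotC dotZr mul0r.
- by exists u.
Qed.

Lemma edge_transversal g n1 n2 : g \subset T -> #|g| = 2 -> edge_normals x g n1 n2 ->
  transversal_dirs T dl g (fun u => exists s t, u = s *: n1 + t *: n2).
Proof.
move=> gT g2 [nn1 nn2 fn] y.
have rowE (z : 'rV[R]_(1 + 1)) : exists s t, z *m col_mx n1 n2 = s *: n1 + t *: n2.
  exists (lsubmx z 0 0), (rsubmx z 0 0); rewrite -{1}(hsubmxK z) mul_row_col.
  by rewrite [lsubmx z]mx11_scalar [rsubmx z]mx11_scalar !mul_scalar_mx !mxE.
have [||u [z uz] uy] := @normals_transversal g 2 _ (card_neq0 g2) _ fn _ y.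
- exact: (card_TD gT g2).
- move=> z; have [s [t ->]] := rowE z.
  by apply: normal_toD; apply: normal_toZ.
- by exists u => //; rewrite uz; exact: rowE.
Qed.

Lemma face_transversal g n : g \subset T -> #|g| = 3 -> face_normal x g n ->
  transversal_dirs T dl g (fun u => exists s, u = s *: n).
Proof.
move=> gT g3 [nn n0] y.
have rowE (z : 'rV[R]_1) : z *m n = z 0 0 *: n.
  by rewrite {1}[z]mx11_scalar mul_scalar_mx.
have [||z|u [z uz] uy] := @normals_transversal g 1 n (card_neq0 g3) _ _ _ y.
- exact: (card_TD gT g3).
- by rewrite /row_free rank_rV n0.
- by rewrite rowE; apply: normal_toZ.
- by exists u => //; rewrite uz; exists (z 0 0).
Qed.

(** There is no opposite coordinate to prescribe; this lets the elimination step be applied to T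
    itself, with derivatives of order 0. *)
Lemma full_transversal : transversal_dirs T dl T (fun=> True).
Proof. by move=> y; exists 0 => // w; rewrite finset.setDv inE. Qed.

Lemma itD_dirD u v j P : itD u j (dirD v P) = dirD v (itD u j P).
Proof. by elim: j => //= j ->; rewrite dirD_comm. Qed.

Lemma itD_partials0 j u P p :
  (forall s : seq 'I_3, size s = j -> ev (dirs s P) p = 0) -> ev (itD u j P) p = 0.
Proof.
elim: j P => [|j IH] P P0; first exact: (P0 [::]).
rewrite itDSr {2}(row_sum_delta u) dirD_sumv itD_sum ev_sum big1 // => i _.
rewrite dirD_scalev itDZ evZ (IH (dirD (e_ i) P)) ?mulr0 // => s sj.
by rewrite -[RHS](P0 (rcons s i)) ?size_rcons ?sj // /dirs foldr_rcons.
Qed.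

Lemma itD_comb0 j n1 n2 s t P p :
  (forall i, (i <= j)%N -> ev (itD n1 i (itD n2 (j - i) P)) p = 0) ->
  ev (itD (s *: n1 + t *: n2) j P) p = 0.
Proof.
(* The power of s n1 + t n2 is expanded one factor at a time: m factors remain, i and l have already
   become n1 and n2, and commutation keeps them sorted. *)
move=> P0; suff H m i l : (i + l + m = j)%N ->
    ev (itD n1 i (itD n2 l (itD (s *: n1 + t *: n2) m P))) p = 0 by exact: (H j 0%N 0%N).
elim: m i l => [|m IH] i l ilm.
  by rewrite -[RHS](P0 i); [congr (ev (itD _ _ (itD _ _ _)) _); lia|lia].
rewrite /= dirD_addv !dirD_scalev.
have ext u c c' A B : itD u c' (c *: A + B) = c *: itD u c' A + itD u c' B.
  by elim: c' => //= c' ->; rewrite dirDD dirDZ.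
rewrite !ext !itDZ evD !evZ -[itD n2 l (dirD n2 _)]itDSr.
have -> : itD n1 i (itD n2 l (dirD n1 (itD (s *: n1 + t *: n2) m P))) =
          itD n1 i.+1 (itD n2 l (itD (s *: n1 + t *: n2) m P)).
  by rewrite itDSr itD_dirD.
by rewrite !IH ?mulr0 ?addr0 //; lia.
Qed.

Lemma itD_scale0 j n s P p : ev (itD n j P) p = 0 -> ev (itD (s *: n) j P) p = 0.
Proof.
move=> P0; have -> : itD (s *: n) j P = s ^+ j *: itD n j P.
  elim: j {P0} => [|j /= ->]; first by rewrite expr0 scale1r.
  by rewrite dirD_scalev dirDZ scalerA exprS.
by rewrite evZ P0 mulr0.
Qed.

End NormalDirections.

(** * Positivity of integrals of polynomials, for a general parametrization *)

Section PolynomialIntegrals.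
Context {R : realType} {V : finType}.
Notation E := ('rV[R]_3).
Notation poly3 := (mpoly 3 R).
Variables (x : V -> E) (T : {set V}) (L : V -> poly3) (dl : E -> V -> R).
Hypotheses (hT : tetrahedron x T) (hL : bary_polys x T L dl).
Implicit Types (g : {set V}) (P Q : poly3) (u p : E).

(** The interface shared by edge, face and volume integrals: locality, additivity on polynomials and
    definiteness. Vanishing on the relative interior is enough, since coefficients are read off
    there. *)
Record poly_integral g (I : (E -> R) -> R) : Prop := PolyIntegral {
  pint_ext : forall w w', (forall p, simplex x g p -> w p = w' p) -> I w = I w';
  pintB : forall P Q, I (fun p => ev P p - ev Q p) = I (ev P) - I (ev Q);
  pint_gt0 : forall P, (forall p, simplex x g p -> 0 <= ev P p) -> I (ev P) = 0 ->
    forall p, relint L g p -> ev P p = 0 }.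

Lemma poly_integralZ g I (c : R) : c != 0 -> poly_integral g I ->
  poly_integral g (fun w => c * I w).
Proof.
move=> c0 [e B pos]; split=> [w w' ww'|P Q|P P0 /eqP].
- by rewrite (e _ _ ww').
- by rewrite B mulrBr.
- by rewrite mulf_eq0 (negPf c0) => /eqP; exact: pos.
Qed.

Lemma simplex_bounded g p i : g \subset T -> simplex x g p ->
  `|p 0 i| <= \sum_v `|x v 0 i|.
Proof.
move=> gT /(simplex_bc hT hL p gT)[_ p0].
have [_ b1 <-] := bc_is_bary hL p; rewrite summxE; apply: le_trans (ler_norm_sum _ _ _) _.
apply: ler_sum => v _; rewrite mxE normrM ger0_norm // ler_piMl //.
by rewrite -b1 (bigD1 v) //= lerDl sumr_ge0.
Qed.

Lemma nbhs_ev_gt P p c : c < ev P p -> nbhs p [set q | c < ev P q].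
Proof. exact: (cvgr_gt (ev P p) (@continuous_ev R P p)). Qed.

Section Parametrization.
Context d (S : measurableType d) (mu : {measure set S -> \bar R}).
Variables (g : {set V}) (phi : S -> E).
(** [phi] parametrizes the whole affine plane of g, not only the simplex. [phi_thick] replaces the
    fact that nonempty open sets have positive measure, and [phi_fin] makes the domain of
    integration finite. *)
Hypotheses (gT : g \subset T)
  (phi_meas : forall i, measurable_fun setT (fun t => phi t 0 i))
  (phi_thick : forall t W, nbhs (phi t) W ->
     exists B, [/\ measurable B, (0 < mu B)%E & B `<=` phi @^-1` W])
  (phi_plane : forall t, on_plane L g (phi t))
  (phi_onto : forall p, on_plane L g p -> exists t, phi t = p)
  (phi_fin : exists K, [/\ measurable K, (mu K < +oo)%E & phi @^-1` simplex x g `<=` K]).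

Let D := [set t | simplex x g (phi t)].

Lemma measurable_ev P : measurable_fun setT (fun t => ev P (phi t)).
Proof.
move: P; apply: (@pol_ind R) => [c|i|P Q mP mQ|P Q mP mQ].
- by rewrite (_ : (fun _ => _) = cst c); [exact: measurable_cst|apply/funext => t; rewrite evC].
- by rewrite (_ : (fun _ => _) = fun t => phi t 0 i) //; apply/funext => t; rewrite ev_pX.
- rewrite (_ : (fun _ => _) = (fun t => ev P (phi t)) \+ (fun t => ev Q (phi t))).
    exact: measurable_funD.
  by apply/funext => t; rewrite evD.
- rewrite (_ : (fun _ => _) = (fun t => ev P (phi t)) \* (fun t => ev Q (phi t))).
    exact: measurable_funM.
  by apply/funext => t; rewrite evM.
Qed.

Lemma param_domE : D = \bigcap_(v in setT) [set t | 0 <= ev (L v) (phi t)].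
Proof.
apply/seteqP; split=> t /=.
  by move/(simplex_bc hT hL (phi t) gT) => [_ p0] v _; have := p0 v; rewrite ffunE.
move=> tL; apply/(simplex_bc hT hL (phi t) gT); split; first exact: phi_plane.
by move=> v; rewrite ffunE; exact: tL.
Qed.

Lemma measurable_param_dom : measurable D.
Proof.
rewrite param_domE; apply: fin_bigcap_measurable => [|v _]; first exact: finite_finset.
rewrite -[X in measurable X]setTI; apply: measurable_fun_le => //.
exact: measurable_ev.
Qed.

Lemma integrable_ev P : mu.-integrable D (EFin \o (fun t => ev P (phi t))).
Proof.
apply: measurable_bounded_integrable; first exact: measurable_param_dom.
- case: phi_fin => K [mK Kfin DK]; apply: le_lt_trans Kfin.
  by apply: le_measure; rewrite ?inE //; exact: measurable_param_dom.
- by apply: measurable_funTS; exact: measurable_ev.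
suff [M PM] : exists M, forall t, D t -> `|ev P (phi t)| <= M.
  exists M; split; first exact: num_real.
  by move=> M' /ltW MM' t Dt; exact: le_trans (PM t Dt) MM'.
move: P; apply: (@pol_ind R) => [c|i|P Q [M hM] [N hN]|P Q [M hM] [N hN]].
- by exists `|c| => t _; rewrite evC.
- by exists (\sum_v `|x v 0 i|) => t Dt; rewrite ev_pX; exact: simplex_bounded Dt.
- exists (M + N) => t Dt; rewrite evD; apply: le_trans (ler_normD _ _) _.
  by rewrite lerD ?hM ?hN.
- by exists (M * N) => t Dt; rewrite evM normrM ler_pM ?hM ?hN.
Qed.

(** For definiteness: if P(p) > 0 at a relative interior point, then P > P(p) / 2 on a set of
    positive measure inside the domain, and the integral of the nonnegative P could not vanish. *)
Lemma param_integral : poly_integral g (fun w => \int[mu]_(t in D) w (phi t)).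
Proof.
split=> [w w' ww'|P Q|P P0 IP p [gp pg]].
- by apply: eq_Rintegral => t; rewrite inE; exact: ww'.
- by apply: RintegralB; [exact: measurable_param_dom|exact: integrable_ev..].
apply/eqP; apply: contraT => Pp0.
have pos : 0 < ev P p.
  rewrite lt_def Pp0 P0 //; apply/(simplex_bc hT hL p gT); split => // v.
  by have [/pg/ltW//|/gp ->] := boolP (v \in g).
have [t tp] := phi_onto gp.
(* The second condition keeps W within the simplex: on the plane of g the other coordinates vanish
   anyway. *)
pose W := [set q | ev P p / 2 < ev P q] `&` [set q | forall v, v \in g -> 0 < ev (L v) q].
have Wp : nbhs (phi t) W.
  rewrite tp; apply: filterI.
    by apply: nbhs_ev_gt; rewrite gtr_pMr // invf_lt1 // ltr1n.
  apply: (@filter_forall E V (fun v q => v \in g -> 0 < ev (L v) q) (nbhs p) _) => v.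
  have [vg|vg] := boolP (v \in g); last exact: nearW.
  have pv : 0 < ev (L v) p by have := pg v vg; rewrite ffunE.
  by apply: filterS (nbhs_ev_gt pv).
have [B [mB B0 BW]] := phi_thick Wp.
have BD : B `<=` D.
  move=> s Bs; apply/(simplex_bc hT hL (phi s) gT); split; first exact: phi_plane.
  move=> v; have [vg|/(phi_plane s) ->//] := boolP (v \in g).
  by have [_ /(_ v vg)/ltW] := BW s Bs; rewrite ffunE.
have mD := measurable_param_dom.
have mP A : measurable_fun A (fun t => (ev P (phi t))%:E).
  by apply/measurable_EFinP; apply: measurable_funTS; exact: measurable_ev.
have I0 : (\int[mu]_(t in D) (ev P (phi t))%:E = 0)%E.
  rewrite -[LHS]fineK; first by congr EFin.
  exact: (integrable_fin_num mD (integrable_ev P)).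
have B_le0 : (\int[mu]_(t in B) (ev P (phi t))%:E <= 0)%E.
  by rewrite -I0; apply: ge0_subset_integral => // s Ds; rewrite lee_fin P0.
have : ((ev P p / 2)%:E * mu B <= 0)%E.
  rewrite -integral_cst //; apply: le_trans B_le0.
  apply: ge0_le_integral => //.
  - by move=> s _; rewrite lee_fin divr_ge0 // ltW.
  - by move=> s Bs; rewrite lee_fin ltW //; case: (BW s Bs).
by rewrite leNgt mule_gt0 // lte_fin divr_gt0.
Qed.

End Parametrization.

End PolynomialIntegrals.

(** * The edge, face and volume integrals *)

Section SimplexIntegrals.
Context {R : realType} {V : finType}.
Notation E := ('rV[R]_3).
Notation poly3 := (mpoly 3 R).
Notation leb := (@lebesgue_measure R).
Variables (x : V -> E) (T : {set V}) (L : V -> poly3) (dl : E -> V -> R).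
Hypotheses (hT : tetrahedron x T) (hL : bary_polys x T L dl).
Implicit Types (g : {set V}) (P Q : poly3) (u p : E).

Lemma thick_R (t : R) U : nbhs t U -> exists B, [/\ measurable B, (0 < leb B)%E & B `<=` U].
Proof.
move=> /nbhs_ballP[e /= e0 eU]; exists (ball t e); split => //.
  by rewrite ball_itv; exact: measurable_itv.
by rewrite lebesgue_measure_ball ?ltW // lte_fin mulrn_wgt0.
Qed.

Lemma thick_R2 (t : R * R) U : nbhs t U ->
  exists B, [/\ measurable B, (0 < (leb \x leb)%E B)%E & B `<=` U].
Proof.
move=> [[U1 U2] /= [/thick_R[B1 [m1 p1 s1]] /thick_R[B2 [m2 p2 s2]]] sU].
exists (B1 `*` B2); split; first exact: measurableX.
  by rewrite product_measure1E // mule_gt0.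
by move=> [a b] [/= /s1 ha /s2 hb]; apply: sU.
Qed.

Lemma thick_R3 (t : R * R * R) U : nbhs t U ->
  exists B, [/\ measurable B, (0 < ((leb \x leb) \x leb)%E B)%E & B `<=` U].
Proof.
move=> [[U1 U2] /= [/thick_R2[B1 [m1 p1 s1]] /thick_R[B2 [m2 p2 s2]]] sU].
exists (B1 `*` B2); split; first exact: measurableX.
  by rewrite product_measure1E // mule_gt0.
by move=> [a b] [/= /s1 ha /s2 hb]; apply: sU.
Qed.

Lemma leb_itv_fin (a b : R) : (leb [set` `[a, b]] < +oo)%E.
Proof. by rewrite lebesgue_measure_itv /=; case: ifP => _; rewrite ltry. Qed.

Lemma leb2_box_fin (a b c d : R) : ((leb \x leb)%E (`[a, b] `*` `[c, d]) < +oo)%E.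
Proof. by rewrite product_measure1E // lte_mul_pinfty ?leb_itv_fin ?ge0_fin_numE ?leb_itv_fin. Qed.

Lemma leb3_box_fin (a b c d e f : R) :
  (((leb \x leb) \x leb)%E (`[a, b] `*` `[c, d] `*` `[e, f]) < +oo)%E.
Proof.
rewrite product_measure1E //; last exact: measurableX.
by rewrite lte_mul_pinfty ?leb_itv_fin ?ge0_fin_numE ?leb2_box_fin.
Qed.

Lemma sum_delta (W : lmodType R) (F : V -> W) (c : R) v0 :
  \sum_v (c * (v == v0)%:R) *: F v = c *: F v0.
Proof.
rewrite (bigD1 v0) //= eqxx mulr1 big1 ?addr0 // => v /negPf ->.
by rewrite mulr0 scale0r.
Qed.

Lemma sum_delta1 (c : R) (v0 : V) : \sum_v (c * (v == v0)%:R) = c.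
Proof.
have := @sum_delta R^o (fun=> 1) c v0; rewrite /GRing.scale /= mulr1 => e.
by rewrite -[RHS]e; apply: eq_bigr => v _; rewrite mulr1.
Qed.

Lemma sum_plane (W : lmodType R) g p (F : V -> W) : on_plane L g p ->
  \sum_v bc L p v *: F v = \sum_(v <- enum g) bc L p v *: F v.
Proof.
move=> gp; rewrite big_enum (bigID (mem g)) /= [X in _ + X]big1 ?addr0 // => v /gp ->.
by rewrite scale0r.
Qed.

Lemma int_edge_poly g : g \subset T -> #|g| = 2%N -> poly_integral x L g (int_edge x g).
Proof.
move=> gT g2; rewrite /int_edge /vertex.
have : size (enum g) = 2%N by rewrite -cardE.
have eg : enum g =i g by move=> v; rewrite mem_enum.
have := enum_uniq g; case Eg: (enum g) eg => [|v0 [|v1 [|]]] //= eg /andP[v01 _] _.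
have {}v01 : v0 != v1 by move: v01; rewrite inE.
have v0g : v0 \in g by rewrite -eg inE eqxx.
have v1g : v1 \in g by rewrite -eg !inE eqxx orbT.
pose l (t : R) : {ffun V -> R} := [ffun v => (1 - t) * (v == v0)%:R + t * (v == v1)%:R].
pose phi (t : R) := x v0 + t *: (x v1 - x v0).
have bphi t : bc L (phi t) = l t.
  have -> : phi t = \sum_v l t v *: x v.
    under eq_bigr do rewrite ffunE scalerDl; rewrite big_split /= !sum_delta /phi.
    by rewrite scalerBr scalerBl scale1r addrA addrAC.
  apply: (bc_comb hT hL) => [v vT|].
    rewrite ffunE; have vg : v \notin g by exact: contra (fintype.subsetP gT v) vT.
    by rewrite (negPf (memPnC vg _ v0g)) (negPf (memPnC vg _ v1g)) !mulr0 addr0.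
  by under eq_bigr do rewrite ffunE; rewrite big_split /= !sum_delta1 subrK.
have pphi t : on_plane L g (phi t).
  move=> v; rewrite -eg bphi ffunE !inE negb_or => /andP[/negPf -> /negPf ->].
  by rewrite !mulr0 addr0.
have DE : [set` `[0, 1]] = [set t | simplex x g (phi t)].
  apply/seteqP; split => t /=.
    rewrite in_itv /= => /andP[t0 t1]; apply/(simplex_bc hT hL _ gT); split; first exact: pphi.
    move=> v; by rewrite bphi ffunE addr_ge0 // mulr_ge0 // subr_ge0.
  move=> /(simplex_bc hT hL _ gT)[_ p0]; rewrite in_itv /=.
  have := p0 v0; have := p0 v1; rewrite bphi !ffunE !eqxx eq_sym (negPf v01).
  by rewrite !mulr0 !mulr1 addr0 add0r => -> /=; rewrite subr_ge0.
(* A zero length would identify the two vertices, which have different barycentric coordinates. *)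
have d0 : Num.sqrt (dot (x v1 - x v0) (x v1 - x v0)) != 0.
  rewrite sqrtr_eq0 -ltNge lt_def; apply/andP; split; last first.
    by rewrite dotE sumr_ge0 // => i _; rewrite -expr2 sqr_ge0.
  apply: contra v01 => /eqP/dot_eq0/eqP; rewrite subr_eq0 => /eqP e.
  have /ffunP/(_ v0) := congr1 (bc L) e.
  rewrite !(bc_vertex hT hL) ?(fintype.subsetP gT) // !ffunE eqxx.
  by case: eqP => // _ /eqP; rewrite eq_sym oner_eq0.
apply: (poly_integralZ d0); rewrite DE; apply: (@param_integral R V x T L dl hT hL _ _ leb g phi gT) => //.
- move=> i; rewrite (_ : (fun _ => _) = fun t => x v0 0 i + t * (x v1 - x v0) 0 i).
    by apply: measurable_funD => //; apply: measurable_funM.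
  by apply/funext => t; rewrite !mxE.
- move=> t W Wt; apply: (thick_R (t := t)).
  have cphi : {for t, continuous phi} by apply: cvgD; [exact: cvg_cst|apply: cvgZr_tmp; exact: cvg_id].
  exact: cphi.
- move=> p gp; exists (bc L p v1); have [_ b1 bp] := bc_is_bary hL p.
  rewrite -[RHS]bp (sum_plane _ gp) Eg !big_cons big_nil addr0.
  have : \sum_v bc L p v *: (1 : R^o) = 1.
    by rewrite -[RHS]b1; apply: eq_bigr => v _; rewrite /GRing.scale /= mulr1.
  rewrite (sum_plane _ gp) Eg !big_cons big_nil addr0 /GRing.scale /= !mulr1 => s1.
  have -> : bc L p v0 = 1 - bc L p v1 by rewrite -s1 addrK.
  by apply/rowP => i; rewrite !mxE; ring.
- by exists [set` `[0, 1]]; split => //; [exact: leb_itv_fin|rewrite DE].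
Qed.

(* Gram--Schmidt: the last factor is the squared norm of the component of [b]
   orthogonal to [a]. *)
Lemma gram_det (a b : E) : dot a a != 0 ->
  dot a a * dot b b - dot a b ^+ 2 = dot a a *
    dot (b - (dot a b / dot a a) *: a) (b - (dot a b / dot a a) *: a).
Proof.
move=> a0; set c := dot a b / dot a a; rewrite -(scaleNr c a) dotDr dotZr.
rewrite [dot (_ + _) b]dotC [dot (_ + _) a]dotC !dotDr !dotZr [dot b a]dotC /c.
by field.
Qed.

Lemma int_face_poly g : g \subset T -> #|g| = 3%N -> poly_integral x L g (int_face x g).
Proof.
move=> gT g3; rewrite /int_face /vertex.
have : size (enum g) = 3%N by rewrite -cardE.
have eg : enum g =i g by move=> v; rewrite mem_enum.
have := enum_uniq g; case Eg: (enum g) eg => [|v0 [|v1 [|v2 [|]]]] //= eg.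
rewrite !inE !andbT negb_or => /andP[/andP[v01 v02] v12] _.
have v0g : v0 \in g by rewrite -eg inE eqxx.
have v1g : v1 \in g by rewrite -eg !inE eqxx orbT.
have v2g : v2 \in g by rewrite -eg !inE eqxx !orbT.
set d1 := x v1 - x v0; set d2 := x v2 - x v0.
pose l (t : R * R) : {ffun V -> R} :=
  [ffun v => (1 - t.1 - t.2) * (v == v0)%:R + t.1 * (v == v1)%:R + t.2 * (v == v2)%:R].
pose phi (t : R * R) := x v0 + t.1 *: d1 + t.2 *: d2.
have phiE (a b : R) : (1 - a - b) *: x v0 + a *: x v1 + b *: x v2 =
    x v0 + a *: d1 + b *: d2.
  by apply/rowP => i; rewrite !mxE; ring.
have bphi t : bc L (phi t) = l t.
  have -> : phi t = \sum_v l t v *: x v.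
    under eq_bigr do rewrite ffunE !scalerDl.
    by rewrite !big_split /= !sum_delta phiE.
  apply: (bc_comb hT hL) => [v vT|].
    rewrite ffunE; have vg : v \notin g by exact: contra (fintype.subsetP gT v) vT.
    rewrite (negPf (memPnC vg _ v0g)) (negPf (memPnC vg _ v1g)) (negPf (memPnC vg _ v2g)).
    by rewrite !mulr0 !addr0.
  under eq_bigr do rewrite ffunE.
  by rewrite !big_split /= !sum_delta1; ring.
have pphi t : on_plane L g (phi t).
  move=> v; rewrite -eg bphi ffunE !inE !negb_or => /and3P[/negPf -> /negPf -> /negPf ->].
  by rewrite !mulr0 !addr0.
have DE : [set t : R * R | [/\ 0 <= t.1, 0 <= t.2 & t.1 + t.2 <= 1]] =
          [set t | simplex x g (phi t)].
  apply/seteqP; split => t /=.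
    move=> [t0 t1 t2]; apply/(simplex_bc hT hL _ gT); split; first exact: pphi.
    move=> v; rewrite bphi ffunE !addr_ge0 // mulr_ge0 //.
    by rewrite -addrA -opprD subr_ge0.
  move=> /(simplex_bc hT hL _ gT)[_ p0].
  have := p0 v0; have := p0 v1; have := p0 v2; rewrite bphi !ffunE !eqxx.
  rewrite (negPf v01) (negPf v02) (negPf v12) ![v1 == _]eq_sym ![v2 == _]eq_sym.
  rewrite (negPf v01) (negPf v02) (negPf v12) !mulr0 !mulr1 !addr0 !add0r => t2 t1 t0.
  by split => //; move: t0; rewrite -addrA -opprD subr_ge0.
(* The point with parameters (a, b) would be the vertex v0, whose coordinate at v2 is 0. *)
have indep (a b : R) : a *: d1 + b *: d2 = 0 -> b = 0.
  move=> ab0; have /ffunP/(_ v2) := bphi (a, b).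
  rewrite /phi /= -addrA ab0 addr0 (bc_vertex hT hL) ?(fintype.subsetP gT) // !ffunE eqxx.
  rewrite eq_sym (negPf v02) [v2 == v1]eq_sym (negPf v12) !mulr0 !add0r mulr1.
  by move/esym.
have dot_ge0 (a : E) : 0 <= dot a a.
  by rewrite dotE sumr_ge0 // => i _; rewrite -expr2 sqr_ge0.
have d10 : dot d1 d1 != 0.
  apply/eqP => /dot_eq0 d0; have /ffunP/(_ v1) := bphi (1, 0).
  rewrite /phi /= d0 scaler0 scale0r !addr0 (bc_vertex hT hL) ?(fintype.subsetP gT) // !ffunE eqxx.
  rewrite eq_sym (negPf v01) (negPf v12) !mulr0 !add0r addr0 mulr1.
  by move/eqP; rewrite eq_sym oner_eq0.
have d0 : Num.sqrt (dot d1 d1 * dot d2 d2 - dot d1 d2 ^+ 2) != 0.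
  (* The orthogonal component of d2 has coefficient 1 at d2, so it cannot vanish by [indep]. *)
  rewrite gram_det // sqrtr_eq0 -ltNge mulr_gt0 // lt_def dot_ge0 andbT //.
  apply/eqP => /dot_eq0; rewrite addrC -scaleNr -[X in _ + X = _]scale1r => /indep/eqP.
  by rewrite oner_eq0.
apply: (poly_integralZ d0); rewrite DE.
apply: (@param_integral R V x T L dl hT hL _ _ (leb \x leb)%E g phi gT) => //.
- move=> i; rewrite (_ : (fun _ => _) = fun t : R * R => x v0 0 i + t.1 * d1 0 i + t.2 * d2 0 i).
    by apply: measurable_funD; [apply: measurable_funD|] => //; apply: measurable_funM.
  by apply/funext => t; rewrite !mxE.
- move=> t W Wt; apply: (thick_R2 (t := t)).
  have cphi : {for t, continuous phi}.
    by apply: cvgD; [apply: cvgD; [exact: cvg_cst|apply: cvgZr_tmp; exact: cvg_fst]|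
                     apply: cvgZr_tmp; exact: cvg_snd].
  exact: cphi.
- move=> p gp; exists (bc L p v1, bc L p v2); have [_ b1 bp] := bc_is_bary hL p.
  rewrite -[RHS]bp (sum_plane _ gp) Eg !big_cons big_nil addr0.
  have : \sum_v bc L p v *: (1 : R^o) = 1.
    by rewrite -[RHS]b1; apply: eq_bigr => v _; rewrite /GRing.scale /= mulr1.
  rewrite (sum_plane _ gp) Eg !big_cons big_nil addr0 /GRing.scale /= !mulr1 => s1.
  have -> : bc L p v0 = 1 - bc L p v1 - bc L p v2 by rewrite -s1; ring.
  by rewrite addrA phiE.
- exists (`[0, 1] `*` `[0, 1]); split; [exact: measurableX|exact: leb2_box_fin|].
  change ([set t | simplex x g (phi t)] `<=` `[0, 1] `*` `[0, 1]).
  rewrite -DE => t [/= t0 t1 t2]; rewrite !in_itv /= t0 t1 /=; split.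
    by apply: le_trans t2; rewrite lerDl.
  by apply: le_trans t2; rewrite lerDr.
Qed.

(** Here the parametrization is the identification of triples with points, and the plane of T is all
    of space; finite measure comes from a box bounding the vertices. *)
Lemma int_tet_poly : poly_integral x L T (int_tet x T).
Proof.
rewrite /int_tet.
have p3E (t : R * R * R) : point3 t = t.1.1 *: e_ 0 + t.1.2 *: e_ 1 + t.2 *: e_ 2%:R.
  apply/rowP => i; rewrite !mxE !eqxx /=.
  by case: i => [[|[|[|//]]] /= ?]; rewrite ?mulr1 ?mulr0 ?addr0 ?add0r.
apply: (@param_integral R V x T L dl hT hL _ _ ((leb \x leb) \x leb)%E T (@point3 R) (subxx _)) => //.
- case=> [[|[|[|//]]] i3].
  + rewrite (_ : (fun _ => _) = fst \o fst); last by apply/funext => t; rewrite mxE.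
    exact: measurableT_comp.
  + rewrite (_ : (fun _ => _) = snd \o fst); last by apply/funext => t; rewrite mxE.
    exact: measurableT_comp.
  + rewrite (_ : (fun _ => _) = snd) //; by apply/funext => t; rewrite mxE.
- move=> t W Wt; apply: (thick_R3 (t := t)).
  have -> : @point3 R = fun t => t.1.1 *: e_ 0 + t.1.2 *: e_ 1 + t.2 *: e_ 2%:R.
    by apply/funext => s; exact: p3E.
  have := Wt; rewrite p3E => Wt';
  apply: (_ : {for t, continuous (fun t : R * R * R =>
    t.1.1 *: e_ 0 + t.1.2 *: e_ 1 + t.2 *: e_ 2%:R)}) => //.
  apply: cvgD; [apply: cvgD|]; apply: cvgZr_tmp; last exact: cvg_snd.
    by apply: (@cvg_comp _ _ _ fst fst); [exact: cvg_fst|exact: cvg_fst].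
  by apply: (@cvg_comp _ _ _ fst snd); [exact: cvg_fst|exact: cvg_snd].
- by move=> t v; exact: (bc_notin hL).
- move=> p _; exists (p 0 0, p 0 1, p 0 2%:R); apply/rowP => i; rewrite mxE /=.
  by case: i => [[|[|[|//]]] i3] /=; congr (p _ _); apply/val_inj.
- pose M i := \sum_v `|x v 0 i|.
  exists (`[- M 0, M 0] `*` `[- M 1, M 1] `*` `[- M 2%:R, M 2%:R]); split.
  + by apply: measurableX => //; apply: measurableX.
  + exact: leb3_box_fin.
  move=> t /= tT; have b i := simplex_bounded hT hL i (subxx _) tT.
  have := b 0; have := b 1; have := b 2%:R; rewrite !mxE /= !ler_norml !in_itv /=.
  by move=> -> -> ->.
Qed.

End SimplexIntegrals.

(** * Elimination of coefficients by vanishing degrees of freedom *)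

Section VanishingDofs.
Context {R : realType} {V : finType}.
Notation E := ('rV[R]_3).
Notation poly3 := (mpoly 3 R).
Variables (x : V -> E) (T : {set V}) (L : V -> poly3) (dl : E -> V -> R).
Hypotheses (hT : tetrahedron x T) (hL : bary_polys x T L dl).
Implicit Types (g h : {set V}) (P Q : poly3) (u p : E) (r : {set V} -> int).

Lemma dist0P g (a : V -> nat) : dist T a g = 0%N -> forall v, v \in T :\: g -> a v = 0%N.
Proof. by move/eqP; rewrite sum_nat_eq0 => /forall_inP a0 v /a0/eqP. Qed.

Lemma dist_sub g h (a : V -> nat) : g \subset T -> h \subset g -> dist T a g = 0%N ->
  dist T a h = (\sum_(v in g :\: h) a v)%N.
Proof.
move=> gT hg a0; rewrite /dist (big_setID g) /= [X in (_ + X)%N]big1 ?addn0 => [|v].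
  apply: eq_bigl => v; rewrite !inE; case: (v \in h) => //=.
  by apply/andP/idP => [[]//|vg]; split => //; exact: (fintype.subsetP gT).
by rewrite !inE => /and3P[vg _ vT]; rewrite (dist0P a0) // inE vg.
Qed.

Lemma ev_mono_on g (a : V -> nat) p : g \subset T -> on_plane L g p -> dist T a g = 0%N ->
  ev (mono T L a) p = \prod_(v in g) bc L p v ^+ a v.
Proof. by move=> gT gp a0; rewrite (ev_mono_plane _ gT gp) a0 mulr1n. Qed.

Lemma ev_mono_off g (a : V -> nat) p : g \subset T -> on_plane L g p ->
  (0 < dist T a g)%N -> ev (mono T L a) p = 0.
Proof. by move=> gT gp a0; rewrite (ev_mono_plane _ gT gp) gtn_eqF // mulr0n. Qed.

Lemma spn_off g d r P p : g \subset T -> g != finset.set0 -> on_plane L g p ->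
  0 <= r g -> spn T L d r P -> ev P p = 0.
Proof.
move=> gT g0 gp rg; elim=> [|c a P' /admP[_ /(_ g gT g0) ag] _ IH]; first by rewrite ev0.
rewrite evD evZ IH (ev_mono_off gT gp) ?mulr0 ?addr0 //.
by rewrite -ltz_nat; exact: le_lt_trans ag.
Qed.

(** Restriction to the plane of g discards the exponents not supported in g; for the others,
    distances in T and within g coincide, so the known bounds become the bubble conditions. *)
Lemma bubble_of_spn g d (s : seq int) r Q : g \subset T ->
  (forall l h, (l < size s)%N -> h \in Delta l g -> s`_l <= r h) ->
  spn T L d r Q ->
  exists2 q, bubble x g d s q & forall p, on_plane L g p -> ev Q p = q p.
Proof.
move=> gT sr dQ.
suff [c cQ] : exists c : {ffun V -> 'I_d.+1} -> R, forall p, on_plane L g p ->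
    ev Q p = \sum_(a in bubble_index g d s) c a * \prod_(v in g) bc L p v ^+ a v.
  eexists; first by exists c.
  by move=> p gp /=; rewrite (bary_eq_bc hT hL gT gp); exact: cQ.
elim: dQ => [|c0 b Q' db _ [c' IH]].
  by exists (fun=> 0) => p _; rewrite ev0 big1 // => a _; rewrite mul0r.
have [b0|b0] := posnP (dist T b g); last first.
  by exists c' => p gp; rewrite evD evZ (ev_mono_off gT gp b0) mulr0 add0r IH.
have [sb rb] := admP _ _ _ _ db.
have sbg : (\sum_(v in g) b v = d)%N.
  by rewrite -sb [RHS](big_setID g) /= (finset.setIidPr gT) -[X in _ = (_ + X)%N]/(dist T b g) b0 addn0.
pose bb : {ffun V -> 'I_d.+1} := [ffun v => if v \in g then inord (b v) else ord0].
have bbE v : v \in g -> bb v = b v :> nat.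
  by move=> vg; rewrite ffunE vg inordK // ltnS -sbg (bigD1 v) //= leq_addr.
have bbI : bb \in bubble_index g d s.
  rewrite inE; apply/and3P; split.
  - by apply/forallP => v; apply/implyP => /negPf vg; rewrite ffunE vg.
  - by rewrite -[X in _ == X]sbg; apply/eqP/eq_bigr.
  - apply/forallP => l; apply/forallP => h; apply/implyP => hl.
    have [hg h0] : h \subset g /\ h != finset.set0.
      by move: hl; rewrite inE => /andP[-> /eqP hc]; split => //; rewrite -card_gt0 hc.
    apply: le_lt_trans (sr l h (ltn_ord l) hl) _.
    have := rb h (fintype.subset_trans hg gT) h0; rewrite (dist_sub gT hg b0).
    by congr (_ < Posz _); apply: eq_bigr => v; rewrite inE => /andP[_ /bbE].
exists (fun a => c0 *+ (a == bb) + c' a) => p gp.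
rewrite evD evZ IH // (ev_mono_on gT gp b0).
under [RHS]eq_bigr do rewrite mulrDl; rewrite big_split /=; congr (_ + _).
rewrite (bigD1 bb) //= eqxx mulr1n [X in _ + X]big1 ?addr0.
  by congr (_ * _); apply: eq_bigr => v /bbE ->.
by move=> a /andP[_ /negPf ->]; rewrite mulr0n mul0r.
Qed.

(** Off the plane of g the function [bary] takes a default value, so a test function is only known
    to agree with a polynomial on that plane. *)
Lemma poly_of_bubble g d (s : seq int) q : g \subset T -> bubble x g d s q ->
  exists Q, forall p, on_plane L g p -> q p = ev Q p.
Proof.
move=> gT [c ->].
exists (\sum_(a in bubble_index g d s) c a *: \prod_(v in g) L v ^+ a v) => p gp.
rewrite ev_sum; apply: eq_bigr => a _; rewrite evZ ev_prod (bary_eq_bc hT hL gT gp).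
by congr (_ * _); apply: eq_bigr => v _; rewrite evX ffunE.
Qed.

Variables (rv re rf : int) (k : nat) (n1 n2 nf : {set V} -> E).
Hypotheses (hrf : -1 <= rf) (hre : -1 <= re) (hrv : -1 <= rv)
  (hef : 2 * rf <= re) (hve : 2 * re <= rv) (hk : 2 * rv + 1 <= k%:Z).
Hypothesis hn : normals_on x n1 n2 nf T.

(** Indexed by cardinality, with -1 for the empty set; the list ends at faces, and the elimination
    uses it only below cardinality 4. *)
Definition order h : int := [:: -1; rv; re; rf]`_#|h|.

Definition vanishing_dofs g P :=
  forall l, dof x rv re rf k n1 n2 nf g l -> l (ev P) = 0.

Lemma simplex_ge0 g p v : g \subset T -> simplex x g p -> 0 <= bc L p v.
Proof. by move=> gT /(simplex_bc hT hL _ gT)[_]. Qed.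

Lemma simplex_plane g p : g \subset T -> simplex x g p -> on_plane L g p.
Proof. by move=> gT /(simplex_bc hT hL _ gT)[]. Qed.

Lemma vertex_stage v r P : v \in T -> -1 <= r [set v]%SET -> spn T L k r P ->
  vanishing_dofs [set v]%SET P -> spn T L k (upd r [set v]%SET rv) P.
Proof.
move=> vT rv1 dP P0; apply: (spn_upd hT hL _ _ (vertex_transversal hT hL vT)) => //.
- by rewrite finset.sub1set.
- by rewrite -card_gt0 cards1.
move=> j u p jr _ [gp _]; have -> : p = x v.
  have [_ b1 <-] := bc_is_bary hL p.
  have b0 w : w != v -> bc L p w = 0 by move=> wv; apply: gp; rewrite inE.
  rewrite (bigD1 v) //= [X in _ + X]big1 ?addr0 => [|w /b0 ->]; last by rewrite scale0r.
  by move: b1; rewrite (bigD1 v) //= [X in _ + X]big1 ?addr0 => [-> |w /b0 //]; rewrite scale1r.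
apply: itD_partials0 => s sj.
by have := P0 _ (@dof_vertex _ _ x rv re rf k n1 n2 nf _ v s erefl _);
  rewrite partials_ev; apply; rewrite sj.
Qed.

(** For an exponent supported on the edge, the distance to one endpoint is the exponent at the
    other; so the bounds at both vertices force the factor (lambda_0 lambda_1)^s. *)
Lemma edge_factor g (v0 v1 : V) d (s : nat) r Q : g \subset T -> v0 != v1 -> g = [set v0; v1]%SET ->
  s%:Z - 1 <= r [set v0]%SET -> s%:Z - 1 <= r [set v1]%SET -> spn T L d r Q ->
  exists2 q, deg_le (d%:Z - 2 * s%:Z) q & forall p, on_plane L g p ->
    ev Q p = (bc L p v0 * bc L p v1) ^+ s * ev q p.
Proof.
move=> gT v01 ge r0 r1; elim=> [|c b Q' /admP[sb rb] _ [q dq IH]].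
  by exists 0; [exact: deg_le0|move=> p _; rewrite !ev0 mulr0].
have [b0|b0] := posnP (dist T b g); last first.
  by exists q => // p gp; rewrite evD evZ (ev_mono_off gT gp b0) mulr0 add0r IH.
have sum_g (A : eqType) (idx : A) (op : Monoid.com_law idx) (F : V -> A) :
    \big[op/idx]_(v in g) F v = op (F v0) (F v1).
  by rewrite ge finset.big_setU1 ?inE //= finset.big_set1.
have v0g : v0 \in g by rewrite ge !inE eqxx.
have v1g : v1 \in g by rewrite ge !inE eqxx orbT.
have sub1 v : v \in g -> [set v]%SET \subset g by rewrite finset.sub1set.
have ne1 v : [set v]%SET != finset.set0 :> {set V} by rewrite -card_gt0 cards1.
have sbg : (b v0 + b v1 = d)%N.
  by rewrite -sb [RHS](big_setID g) /= (finset.setIidPr gT) -[X in _ = (_ + X)%N]/(dist T b g) b0 addn0 sum_g.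
have dv0 : dist T b [set v0]%SET = b v1.
  rewrite (dist_sub gT (sub1 _ v0g) b0) (_ : g :\: _ = [set v1]%SET) ?finset.big_set1 //.
  by apply/finset.setP => v; rewrite ge !inE; case: eqP => // ->; rewrite (negPf v01).
have dv1 : dist T b [set v1]%SET = b v0.
  rewrite (dist_sub gT (sub1 _ v1g) b0) (_ : g :\: _ = [set v0]%SET) ?finset.big_set1 //.
  by apply/finset.setP => v; rewrite ge !inE orbC; case: eqP => // ->; rewrite eq_sym (negPf v01).
have := rb _ (fintype.subset_trans (sub1 _ v0g) gT) (ne1 v0); rewrite dv0 => b1.
have := rb _ (fintype.subset_trans (sub1 _ v1g) gT) (ne1 v1); rewrite dv1 => b2.
have s1 : (s <= b v1)%N by lia.
have s2 : (s <= b v0)%N by lia.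
exists (c *: (L v0 ^+ (b v0 - s) * L v1 ^+ (b v1 - s)) + q).
  apply: deg_leD dq; apply: deg_leZ.
  apply: (@deg_leW _ ((b v0 - s)%N%:Z + (b v1 - s)%N%:Z)); first by lia.
  have e (n : nat) : n%:Z = 1 *+ n by rewrite -mulr_natr mul1r natz.
  by apply: deg_leM; rewrite e; apply: deg_leX; exact: (bary_deg hL).
move=> p gp; rewrite !evD !evZ IH // (ev_mono_on gT gp b0) sum_g mulrDr /=; congr (_ + _).
rewrite evM !evX -{1}(subnK s2) -{1}(subnK s1) !exprD exprMn !ffunE.
by ring.
Qed.

Lemma edge_stage g r P : g \subset T -> #|g| = 2%N -> -1 <= r g ->
  (forall v, v \in g -> rv <= r [set v]%SET) -> spn T L k r P ->
  vanishing_dofs g P -> spn T L k (upd r g re) P.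
Proof.
move=> gT g2 rg rgv dP P0.
have en : edge_normals x g (n1 g) (n2 g) by apply: hn.1; rewrite inE gT g2.
apply: (spn_upd hT hL gT _ (edge_transversal hT hL gT g2 en)) => //.
  by rewrite -card_gt0 g2.
move=> j u p jr [s [t ->]] rp; apply: itD_comb0 => i ij.
set Q := itD _ _ _.
have [v0 [v1 v01 ge]] : exists v0, exists2 v1, v0 != v1 & g = [set v0; v1]%SET.
  have /cards2P[v0 [v1 [v01 ge]]] : #|g| == 2%N by rewrite g2.
  by exists v0, v1.
have dQ : spn T L (k - (j - i) - i) (fun h => r h - (j - i)%N%:Z - i%:Z) Q.
  by apply: (spn_itD hL); apply: (spn_itD hL).
(* After j derivatives the vertex bound is rv - j, whence s = rv + 1 - j, which is nonnegative as j
   <= re <= rv. The cofactor has degree (k - j) - 2 s = k - 2(rv + 1) + j, exactly the test degree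
   in (S1). *)
pose sn : nat := absz (rv + 1 - j%:Z)%R.
have v0g : v0 \in g by rewrite ge !inE eqxx.
have v1g : v1 \in g by rewrite ge !inE eqxx orbT.
have [||q dq Qq] := edge_factor (s := sn) gT v01 ge _ _ dQ.
- by have := rgv _ v0g; rewrite /sn; lia.
- by have := rgv _ v1g; rewrite /sn; lia.
have int0 : int_edge x g (ev (Q * q)) = 0.
  have hq : polyspace (k%:Z - 2 * (rv + 1) + j%:Z) (ev q).
    by apply/polyspaceP; exists q => //; apply: deg_leW dq; rewrite /sn; lia.
  rewrite -[RHS](P0 _ (@dof_edge _ _ x rv re rf k n1 n2 nf g i j (ev q) g2 ij jr hq)).
  by congr int_edge; apply/funext => z; rewrite evM !iterD_ev.
have := pint_gt0 (int_edge_poly hT hL gT g2) _ int0 rp.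
have QqE z : on_plane L g z -> ev (Q * q) z = (bc L z v0 * bc L z v1) ^+ sn * ev q z ^+ 2.
  by move=> gz; rewrite evM Qq // -mulrA -expr2.
rewrite QqE; last by case: rp.
move=> /(_ _)/wrap[|].
  move=> z gz; rewrite QqE; last exact: simplex_plane gz.
  by rewrite mulr_ge0 ?sqr_ge0 // exprn_ge0 // mulr_ge0 //; exact: simplex_ge0 gz.
move/eqP; rewrite mulf_eq0 expf_eq0 gt_eqF ?andbF /=; last by apply: mulr_gt0; apply: rp.2.
rewrite sqrf_eq0 => /eqP q0; rewrite Qq ?q0 ?mulr0 //.
by case: rp.
Qed.

Lemma face_stage g r P : g \subset T -> #|g| = 3%N -> -1 <= r g ->
  (forall h, h \subset g -> (0 < #|h| < 3)%N -> order h <= r h) -> spn T L k r P ->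
  vanishing_dofs g P -> spn T L k (upd r g rf) P.
Proof.
move=> gT g3 rg rgh dP P0.
have fn : face_normal x g (nf g) by apply: hn.2; rewrite inE gT g3.
apply: (spn_upd hT hL gT _ (face_transversal hT hL gT g3 fn)) => //.
  by rewrite -card_gt0 g3.
move=> j u p jr [s ->] rp; apply: itD_scale0.
set Q := itD _ _ _.
have dQ : spn T L (k - j) (fun h => r h - j%:Z) Q by apply: (spn_itD hL).
have [|q bq Qq] := bubble_of_spn (s := [:: rv - j%:Z; re - j%:Z]) gT _ dQ.
  move=> l h ls; rewrite inE => /andP[hg /eqP hc].
  have := rgh h hg; rewrite /order hc; case: l ls {hc} => [|[|//]] _ /= /(_ isT) ?; lia.
have int0 : int_face x g (ev (Q * Q)) = 0.
  rewrite -[RHS](P0 _ (@dof_face _ _ x rv re rf k n1 n2 nf g j q g3 jr bq)).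
  apply: (pint_ext (int_face_poly hT hL gT g3)) => z gz.
  by rewrite evM iterD_ev Qq //; exact: simplex_plane gz.
have := pint_gt0 (int_face_poly hT hL gT g3) _ int0 rp.
move=> /(_ _)/wrap[z _|/eqP]; first by rewrite evM -expr2 sqr_ge0.
by rewrite evM mulf_eq0 orbb => /eqP.
Qed.

Lemma stage g r P : g \subset T -> (0 < #|g| < 4)%N -> -1 <= r g ->
  (forall h, h \subset g -> (0 < #|h| < #|g|)%N -> order h <= r h) -> spn T L k r P ->
  vanishing_dofs g P -> spn T L k (upd r g (order g)) P.
Proof.
move=> gT; rewrite /order; case g1: #|g| => [|[|[|[|//]]]] //= _ rg rgh dP P0.
- have /cards1P[v gv] : #|g| == 1%N by rewrite g1.
  by rewrite gv in gT rg P0 *; apply: vertex_stage => //; rewrite -finset.sub1set.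
- apply: edge_stage => // v vg.
  by have := rgh [set v]%SET; rewrite finset.sub1set cards1 => /(_ vg isT).
- by apply: face_stage.
Qed.

(** Outer induction on cardinality, inner induction over a list of all subsets. Bounds never
    decrease, so those reached for smaller faces remain available. *)
Lemma stages g r P : g \subset T -> (forall h, -1 <= r h) -> spn T L k r P ->
  (forall h, h \subset g -> vanishing_dofs h P) ->
  exists r', [/\ spn T L k r' P, forall h, -1 <= r' h &
    forall h, h \subset g -> (0 < #|h| < 4)%N -> order h <= r' h].
Proof.
move=> gT rm dP P0.
suff H n : (n <= 4)%N -> exists r', [/\ spn T L k r' P, forall h, -1 <= r' h &
    forall h, h \subset g -> (0 < #|h| < n)%N -> order h <= r' h] by exact: H.
elim: n => [|n IH] n4; first by exists r; split => // h _; rewrite ltn0 andbF.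
have [r1 [d1 m1 o1]] := IH (ltnW n4).
have [n0|n0] := posnP n; first by exists r1; split => // h _; rewrite n0; case: #|h|.
suff [r2 [d2 m2 o2 s2]] : exists r2, [/\ spn T L k r2 P, forall h, -1 <= r2 h,
    forall h, r1 h <= r2 h &
    forall h, h \in enum [set: {set V}] -> h \subset g -> #|h| = n -> order h <= r2 h].
  exists r2; split => // h hg /andP[h0]; rewrite ltnS leq_eqVlt => /orP[/eqP hn'|hn'].
    by apply: s2 => //; rewrite mem_enum inE.
  by apply: le_trans (o2 h); apply: o1 => //; rewrite h0.
elim: (enum _) => [|h s [r2 [d2 m2 o2 s2]]]; first by exists r1.
have [/andP[hg /eqP hc]|nh] := boolP ((h \subset g) && (#|h| == n)); last first.
  exists r2; split => // h'; rewrite inE => /orP[/eqP -> hg hc|]; last exact: s2.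
  by rewrite hg hc eqxx in nh.
exists (upd r2 h (order h)); split.
- apply: stage => //; [exact: fintype.subset_trans gT|by rewrite hc n0|  |exact: P0].
  move=> h' h'h; rewrite hc => h'n; apply: le_trans (o2 h'); apply: o1 => //.
  exact: fintype.subset_trans hg.
- by move=> h'; rewrite /upd; case: eqP => // _; rewrite le_max m2.
- by move=> h'; rewrite /upd; case: eqP => // ->; rewrite le_max o2.
- move=> h'; rewrite inE /upd => /orP[/eqP -> _ _|h's h'g h'n].
    by rewrite eqxx le_max lexx orbT.
  by case: eqP => [->|_]; [rewrite le_max lexx orbT|exact: s2].
Qed.

Lemma vanishing_dofs0 P : deg_le k%:Z P ->
  (forall h, h \subset T -> vanishing_dofs h P) -> P = 0.
Proof.
move=> kP P0; have [|r [dP rm ro]] := stages (subxx T) _ (bernstein hL kP) P0; first by [].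
have [|q bq Pq] := bubble_of_spn (s := [:: rv; re; rf]) (subxx T) _ dP.
  move=> l h ls; rewrite inE => /andP[hT' /eqP hc].
  have := ro h hT'; rewrite /order hc; by case: l ls {hc} => [|[|[|//]]] _ /= /(_ isT).
have int0 : int_tet x T (ev (P * P)) = 0.
  rewrite -[RHS](P0 _ (subxx T) _ (@dof_tet _ _ x rv re rf k n1 n2 nf T q hT.1 bq)).
  apply: (pint_ext (int_tet_poly hT hL)) => z gz.
  by rewrite evM Pq //; exact: simplex_plane gz.
have T0 : T != finset.set0 by rewrite -card_gt0 hT.1.
(* The bound 0 at T cannot be met, because every exponent has distance 0 from T; so the span is
   reduced to 0. *)
have : spn T L k (upd r T 0) P.
  apply: (spn_upd hT hL (subxx T) T0 (full_transversal T dl)) => // j u p j0 _ rp.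
  have -> : j = 0%N by move: j0; case: j.
  have := pint_gt0 (int_tet_poly hT hL) _ int0 rp.
  move=> /(_ _)/wrap[z _|/eqP]; first by rewrite evM -expr2 sqr_ge0.
  by rewrite evM mulf_eq0 orbb => /eqP.
case=> // c a P' /admP[_ /(_ T (subxx T) T0)].
by rewrite /dist finset.setDv big_set0 /upd eqxx => ? _; lia.
Qed.

End VanishingDofs.

(** * Well-definedness of the dimension *)

Section DimensionUniqueness.
Context {R : realType} {X : Type}.
Variables (D : set X) (S : set (X -> R)).

(** The matrix expressing one basis in the other is row free, so its number of rows is bounded by
    its number of columns. *)
Lemma basis_size_le n n' (b : 'I_n -> X -> R) (b' : 'I_n' -> X -> R) :
  basis_on D S b -> basis_on D S b' -> (n' <= n)%N.
Proof.
move=> [_ _ gen] [b'S free _].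
have [C CE] := choice (fun i => gen (b' i) (b'S i)).
pose M : 'M[R]_(n', n) := \matrix_(i, j) C i j.
suff /eqP <- : row_free M by exact: rank_leq_col.
rewrite -kermx_eq0; apply/eqP/row_matrixP => i0; rewrite row0.
set y := row i0 _; have yM : y *m M = 0 by rewrite /y -row_mul mulmx_ker row0.
apply/rowP => i; rewrite [RHS]mxE; apply: (free (fun i => y 0 i)) => p Dp.
under eq_bigr do rewrite CE // mulr_sumr.
rewrite exchange_big big1 // => j _; under eq_bigr do rewrite mulrA.
rewrite -mulr_suml; have /rowP/(_ j) := yM; rewrite mxE [RHS]mxE => e.
by rewrite (_ : \sum_i _ = 0) ?mul0r // -[RHS]e; apply: eq_bigr => l _; rewrite [M _ _]mxE.
Qed.

Lemma dim_onE n (b : 'I_n -> X -> R) : basis_on D S b -> dim_on D S = n.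
Proof.
move=> bb; rewrite /dim_on; case: xgetP => [m _ [b' bb']|/(_ n)]; last by case; exists b.
by apply/eqP; rewrite eqn_leq (basis_size_le bb bb') (basis_size_le bb' bb).
Qed.

End DimensionUniqueness.

(** * Dimensions of the test and shape spaces as numbers of exponents *)

Section Dimensions.
Context {R : realType} {V : finType}.
Notation E := ('rV[R]_3).
Notation poly3 := (mpoly 3 R).
Variables (x : V -> E) (T : {set V}) (L : V -> poly3) (dl : E -> V -> R).
Hypotheses (hT : tetrahedron x T) (hL : bary_polys x T L dl).
Implicit Types (g h : {set V}) (P Q : poly3) (u p : E).

Lemma relint_simplex g p : g \subset T -> relint L g p -> simplex x g p.
Proof.
move=> gT [gp pg]; apply/(simplex_bc hT hL _ gT); split=> // v.
by have [/pg/ltW//|/gp ->] := boolP (v \in g).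
Qed.

Lemma bernstein_free g d (A : {set {ffun V -> 'I_d.+1}}) (c : {ffun V -> 'I_d.+1} -> R) :
  g \subset T -> g != finset.set0 -> A \subset bubble_index g d [::] ->
  (forall p, relint L g p ->
     \sum_(a in A) c a * \prod_(v in g) bc L p v ^+ a v = 0) ->
  forall a, a \in A -> c a = 0.
Proof.
move=> gT g0 Ag c0; apply: monomials_free => z z0.
have [s0 [p rp pl]] := relint_ratios hT hL gT g0 z0.
set s := \sum_(v in g) z v in s0 pl; have := c0 p rp.
(* All monomials have degree d, so multiplying by s ^ d undoes the normalisation of the
   coordinates. *)
move/(congr1 (fun t => s ^+ d * t)); rewrite mulr0 mulr_sumr => e.
rewrite -[RHS]e; apply: eq_bigr => a /(fintype.subsetP Ag).
rewrite mem_index0 => /andP[/forallP ag /eqP sa].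
have -> : \prod_v z v ^+ a v = \prod_(v in g) z v ^+ a v.
  rewrite (bigID (mem g)) /= [X in _ * X]big1 ?mulr1 // => v vg.
  by have := ag v; rewrite vg => /eqP ->.
have -> : \prod_(v in g) bc L p v ^+ a v = (\prod_(v in g) z v ^+ a v) / s ^+ d.
  have -> : s ^+ d = \prod_(v in g) s ^+ a v by rewrite prodrXr; congr (_ ^+ _).
  rewrite -prodf_div; apply: eq_bigr => v vg.
  by rewrite pl // expr_div_n.
have sd0 : s ^+ d != 0 by rewrite expf_neq0 // gt_eqF.
by field.
Qed.

Lemma index_sub g d s : bubble_index g d s \subset bubble_index g d [::].
Proof.
by apply/fintype.subsetP => a; rewrite mem_index0 inE => /and3P[-> ->].
Qed.

Lemma sum_enum_index (W : nmodType) d g s (F : {ffun V -> 'I_d.+1} -> W) :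
  \sum_(i < #|bubble_index g d s|) F (enum_val i) = \sum_(a in bubble_index g d s) F a.
Proof. by rewrite [RHS]big_enum_val. Qed.

Lemma bernstein_free_enum g d s (c : 'I_#|bubble_index g d s| -> R)
    (b : 'I_#|bubble_index g d s| -> E -> R) : g \subset T -> g != finset.set0 ->
  (forall i p, on_plane L g p -> b i p = \prod_(v in g) bc L p v ^+ enum_val i v) ->
  (forall p, simplex x g p -> \sum_i c i * b i p = 0) -> forall i, c i = 0.
Proof.
move=> gT g0 bE c0 i.
pose e a := \sum_j c j *+ (enum_val j == a).
have eE j : e (enum_val j) = c j.
  rewrite /e (bigD1 j) //= eqxx mulr1n big1 ?addr0 // => l lj.
  by rewrite (inj_eq enum_val_inj) (negPf lj).
rewrite -eE; apply: (bernstein_free gT g0 (index_sub g d s) _ (enum_valP i)) => p rp.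
rewrite -sum_enum_index -[RHS](c0 p (relint_simplex gT rp)); apply: eq_bigr => j _.
by rewrite eE bE //; case: rp.
Qed.

Lemma dim_bubble g d s : g \subset T -> g != finset.set0 ->
  dim_on (simplex x g) (bubble x g d s) = #|bubble_index g d s|.
Proof.
move=> gT g0.
apply: (@dim_onE _ _ _ _ _ (fun (i : 'I_#|bubble_index g d s|) p =>
  \prod_(v in g) bary x g p v ^+ enum_val i v)); split.
- move=> i; exists (fun a => (a == enum_val i)%:R); apply/funext => p.
  rewrite (bigD1 (enum_val i)) ?enum_valP //= eqxx mul1r [X in _ + X]big1 ?addr0 // => a /andP[_ /negPf ->].
  by rewrite mul0r.
- move=> c; apply: bernstein_free_enum => // i p gp.
  by rewrite (bary_eq_bc hT hL gT gp).
- move=> _ [c ->]; exists (fun i => c (enum_val i)) => p _.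
  by rewrite -[LHS]sum_enum_index.
Qed.

Lemma deg_bernstein g d (a : {ffun V -> 'I_d.+1}) : a \in bubble_index g d [::] ->
  deg_le d%:Z (\prod_(v in g) L v ^+ a v).
Proof.
rewrite mem_index0 => /andP[_ /eqP sa];
suff : deg_le (\sum_(v in g) nmap a v)%N%:Z (\prod_(v in g) L v ^+ nmap a v).
  by rewrite [X in Posz X]sa.
apply: (big_ind2 (fun (P : poly3) (n : nat) => deg_le n%:Z P)).
- by rewrite -mpolyC1; exact: deg_leC.
- by move=> P n Q m dP dQ; rewrite PoszD; exact: deg_leM.
- move=> v _; have e (n : nat) : n%:Z = 1 *+ n by rewrite -mulr_natr mul1r natz.
  by rewrite e; apply: deg_leX; exact: (bary_deg hL).
Qed.

(** On the simplex g the monomials in the coordinates of g alone form a basis; generation is the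
    bubble restriction with an empty list of conditions. *)
Lemma dim_polyspace g d : g \subset T -> g != finset.set0 ->
  dim_on (simplex x g) (@polyspace R d%:Z) = #|bubble_index g d [::]|.
Proof.
move=> gT g0.
apply: (@dim_onE _ _ _ _ _ (fun i : 'I_#|bubble_index g d [::]| =>
  ev (\prod_(v in g) L v ^+ enum_val i v))); split.
- move=> i; apply/polyspaceP; eexists; last by [].
  exact: deg_bernstein (enum_valP i).
- move=> c; apply: bernstein_free_enum => // i p gp.
  by rewrite ev_prod; apply: eq_bigr => v _; rewrite evX ffunE.
- move=> _ /polyspaceP[P dP ->].
  have [//|q [c qE] Pq] := bubble_of_spn hT hL (s := [::]) gT _ (bernstein hL dP).
  exists (fun i => c (enum_val i)) => p gp.
  have pp := simplex_plane hT hL gT gp.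
  rewrite Pq // qE -[LHS]sum_enum_index; apply: eq_bigr => i _.
  congr (_ * _); rewrite ev_prod; apply: eq_bigr => v _.
  by rewrite evX (bary_eq_bc hT hL gT pp) ffunE.
Qed.

Lemma dim_polyspace_neg g d : d < 0 -> dim_on (simplex x g) (@polyspace R d) = 0%N.
Proof.
move=> d0; apply: (@dim_onE _ _ _ _ 0%N (fun _ _ => 0)); split=> [[]//|c _ []//|].
move=> _ /polyspaceP[P /(deg_le_lt0 d0) -> ->]; exists (fun=> 0) => p _.
by rewrite ev0 big_ord0.
Qed.

Lemma card_T_neq0 : T != finset.set0.
Proof. by rewrite -card_gt0 hT.1. Qed.

Lemma ev_inj d P : deg_le d%:Z P -> (forall p, simplex x T p -> ev P p = 0) -> P = 0.
Proof.
move=> dP P0; have := bernstein hL dP => /spn_coefs[c Pc]; rewrite Pc big1 // => a aA.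
suff -> : c a = 0 by rewrite scale0r.
pose A := [set a in bubble_index T d [::] | adm T d (fun=> -1) (nmap a)].
have AT : A \subset bubble_index T d [::].
  by apply/fintype.subsetP => b; rewrite inE => /andP[].
apply: (bernstein_free (subxx T) card_T_neq0 AT); last by rewrite inE.
move=> p rp; rewrite -[RHS](P0 p (relint_simplex (subxx T) rp)) Pc ev_sum.
apply: eq_big => [b|b _]; first by rewrite inE.
by rewrite evZ ev_mono.
Qed.

(* Counts the multi-indices of degree at most [d] by comparing the monomial basis
   with the Bernstein basis. *)
Lemma card_bmultinom3 d : #|{: bmultinom 3 d.+1}| = #|bubble_index T d [::]|.
Proof.
rewrite -(dim_polyspace d (subxx T) card_T_neq0); apply/esym.
pose X (m : bmultinom 3 d.+1) : poly3 := mpolyX R (bmnm m).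
have dX m : deg_le d%:Z (X m).
  by move=> a; rewrite msuppX inE => /eqP ->; rewrite lez_nat -ltnS bmdeg.
have sumE (F : bmultinom 3 d.+1 -> poly3) :
  \sum_(i < #|{: bmultinom 3 d.+1}|) F (enum_val i) = \sum_m F m.
  by rewrite [RHS](big_enum_val F).
apply: (@dim_onE _ _ _ _ _ (fun i : 'I_#|{: bmultinom 3 d.+1}| => ev (X (enum_val i)))); split.
- by move=> i; apply/polyspaceP; exists (X (enum_val i)).
- move=> c c0 i.
  have P0 : \sum_j c j *: X (enum_val j) = 0.
    apply: (@ev_inj d) => [|p /c0 e].
      apply: (big_ind (deg_le d%:Z)) => [|P Q|j _]; [exact: deg_le0|exact: deg_leD|].
      exact: deg_leZ.
    by rewrite ev_sum -[RHS]e; apply: eq_bigr => j _; rewrite evZ.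
  have := congr1 (mcoeff (bmnm (enum_val i))) P0.
  rewrite mcoeff0 raddf_sum (bigD1 i) //= mcoeffZ mcoeffX eqxx mulr1 big1 ?addr0 // => j ji.
  rewrite mcoeffZ mcoeffX; case: eqP => [/val_inj/enum_val_inj e|_]; last by rewrite mulr0.
  by rewrite e eqxx in ji.
- move=> _ /polyspaceP[P dP ->].
  exists (fun i => mcoeff (bmnm (enum_val i)) P) => p _.
  under eq_bigr do rewrite -evZ.
  rewrite -ev_sum (sumE (fun m => mcoeff (bmnm m) P *: X m)); congr (ev _ p).
  rewrite [LHS](mpolywE (k := d.+1)) // msizeE.
  by apply/bigmax_leqP_seq => m mP _; rewrite ltnS; have := dP m mP; rewrite lez_nat.
Qed.

End Dimensions.

Lemma sum_at_most_one (I : finType) (A : {set I}) (B : pred I) :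
  (forall i j, i \in A -> j \in A -> B i -> B j -> i = j) ->
  (\sum_(i in A) B i)%N = [exists i in A, B i].
Proof.
move=> uB; have [/existsP[i /andP[iA Bi]]|] := boolP [exists i in A, B i].
  rewrite (bigD1 i) //= Bi big1 // => j /andP[jA ji]; apply/eqP; rewrite eqb0.
  by apply: contra ji => Bj; apply/eqP; apply: uB.
rewrite negb_exists => /forallP nB; rewrite big1 // => i iA.
by have := nB i; rewrite iA /= => /negPf ->.
Qed.

(** * Partition of the exponents by the first face they are close to *)

Section BernsteinIndices.
Context {V : finType}.
Variable T : {set V}.
Implicit Types (g h : {set V}).

Lemma index_sum g d (a : {ffun V -> 'I_d.+1}) : a \in bubble_index g d [::] ->
  (\sum_(v in g) a v)%N = d.
Proof. by rewrite mem_index0 => /andP[_ /eqP]. Qed.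

Lemma index_out g d (a : {ffun V -> 'I_d.+1}) v : a \in bubble_index g d [::] ->
  v \notin g -> a v = 0%N :> nat.
Proof. by rewrite mem_index0 => /andP[/forallP/(_ v)/implyP av _] /av/eqP. Qed.

(* The bijection [a = b + s] on [g], [a = t] on [T :\: g]. *)
Lemma card_shift g d k (A : {set {ffun V -> 'I_k.+1}}) (B : {set {ffun V -> 'I_d.+1}})
    (s t : V -> nat) : g \subset T ->
  A \subset bubble_index T k [::] -> B \subset bubble_index g d [::] ->
  (d + \sum_(v in g) s v + \sum_(v in T :\: g) t v = k)%N ->
  (forall a, a \in A -> (forall v, v \in g -> (s v <= a v)%N) /\
     (forall v, v \in T :\: g -> a v = t v :> nat)) ->
  (forall a b, a \in bubble_index T k [::] -> b \in bubble_index g d [::] ->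
     (forall v, v \in g -> (b v + s v = a v)%N) ->
     (forall v, v \in T :\: g -> a v = t v :> nat) -> (a \in A) = (b \in B)) ->
  #|A| = #|B|.
Proof.
move=> gT AT Bg dk hA hAB.
have gE v : v \in T -> v \notin g -> v \in T :\: g by move=> vT vg; rewrite inE vg.
(* The entries fit below k + 1 because the total of b, s and t is k, so [inord] does not alter
   them. *)
pose G (b : {ffun V -> 'I_d.+1}) : {ffun V -> 'I_k.+1} :=
  [ffun v => if v \in g then inord (b v + s v) else if v \in T then inord (t v) else ord0].
pose F (a : {ffun V -> 'I_k.+1}) : {ffun V -> 'I_d.+1} :=
  [ffun v => if v \in g then inord (a v - s v) else ord0].
have GE b v : b \in bubble_index g d [::] -> v \in g -> G b v = (b v + s v)%N :> nat.
  move=> bg vg; rewrite ffunE vg inordK // ltnS -dk.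
  have := index_sum bg; rewrite (bigD1 v vg) [X in (_ + X + _)%N](bigD1 v vg) /=; lia.
have GEt b v : v \in T :\: g -> G b v = t v :> nat.
  move=> vTg; move: (vTg); rewrite inE => /andP[/negPf vg vT].
  by rewrite ffunE vg vT inordK // ltnS -dk (bigD1 v vTg) /=; lia.
have GT b : b \in bubble_index g d [::] -> G b \in bubble_index T k [::].
  move=> bg; rewrite mem_index0; apply/andP; split.
    apply/forallP => v; apply/implyP => vT; rewrite ffunE (negPf vT).
    by rewrite (negPf (contra (fintype.subsetP gT v) vT)).
  apply/eqP; rewrite (big_setID g) /= (finset.setIidPr gT) -[RHS]dk.
  congr (_ + _)%N; last by apply: eq_bigr => v; exact: GEt.
  by rewrite (eq_bigr _ (fun v => GE b v bg)) big_split /= (index_sum bg).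
have GA b : b \in bubble_index g d [::] -> (G b \in A) = (b \in B).
  move=> bg; apply: hAB => // [|v vg|v]; [exact: GT|by rewrite GE|exact: GEt].
have FE a : a \in A -> [/\ F a \in bubble_index g d [::],
    forall v, v \in g -> (F a v + s v = a v)%N & G (F a) = a].
  move=> aA; have [as_ at_] := hA a aA; have aT := fintype.subsetP AT a aA.
  have sg : (\sum_(v in g) (a v - s v) = d)%N.
    have := index_sum aT; rewrite (big_setID g) /= (finset.setIidPr gT) (eq_bigr _ at_) => e.
    have : (\sum_(v in g) a v = \sum_(v in g) (a v - s v) + \sum_(v in g) s v)%N.
      by rewrite -big_split; apply: eq_bigr => v vg /=; rewrite subnK ?as_.
    by move=> e2; move: e; rewrite e2 -[RHS]dk => /eqP; rewrite !eqn_add2r => /eqP.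
  have Fv v : v \in g -> F a v = (a v - s v)%N :> nat.
    by move=> vg; rewrite ffunE vg inordK // ltnS -sg (bigD1 v) //= leq_addr.
  have Fs v : v \in g -> (F a v + s v = a v)%N by move=> vg; rewrite Fv // subnK // as_.
  have Fg : F a \in bubble_index g d [::].
    rewrite mem_index0; apply/andP; split.
      by apply/forallP => v; apply/implyP => /negPf vg; rewrite ffunE vg.
    by apply/eqP; rewrite -[RHS]sg; apply: eq_bigr => v; exact: Fv.
  split => //; apply/ffunP => v; apply: val_inj => /=.
  have [vg|vg] := boolP (v \in g); first by rewrite GE // Fs.
  have [vT|vT] := boolP (v \in T); first by rewrite GEt ?gE // at_ // gE.
  by rewrite (index_out (GT _ Fg) vT) (index_out aT vT).
have -> : A = G @: B.
  apply/finset.setP => a; apply/idP/imsetP => [aA|[b bB ->]].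
    by have [Fg _ Ga] := FE a aA; exists (F a) => //; rewrite -GA // Ga.
  by rewrite GA //; exact: fintype.subsetP Bg b bB.
apply: card_in_imset => b b' /(fintype.subsetP Bg) bg /(fintype.subsetP Bg) b'g /ffunP e.
apply/ffunP => v; apply: val_inj => /=.
have [vg|vg] := boolP (v \in g); last by rewrite (index_out bg vg) (index_out b'g vg).
by have := congr1 val (e v); rewrite /= !GE // => /addIn.
Qed.

(** A vertex outside the intersection is outside one of the two sets. This is why each order is
    required to be at least twice the next. *)
Lemma dist_cap g h (a : V -> nat) : (dist T a (g :&: h) <= dist T a g + dist T a h)%N.
Proof.
rewrite /dist big_mkcond [X in (_ <= X + _)%N]big_mkcond [X in (_ <= _ + X)%N]big_mkcond.
rewrite -big_split; apply: leq_sum => v _; rewrite !inE negb_and.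
by case: (v \in g); case: (v \in h); case: (v \in T); rewrite //= ?addn0 ?leq_addr.
Qed.

Lemma dist_set0 (a : V -> nat) : dist T a finset.set0 = (\sum_(v in T) a v)%N.
Proof. by rewrite /dist finset.setD0. Qed.

Variables (rv re rf : int) (k : nat).
Hypotheses (hrf : -1 <= rf) (hre : -1 <= re) (hrv : -1 <= rv)
  (hef : 2 * rf <= re) (hve : 2 * re <= rv) (hk : 2 * rv + 1 <= k%:Z).

Let I := bubble_index T k [::].
Implicit Type a : {ffun V -> 'I_k.+1}.

Definition close (l : nat) (r : int) a : bool :=
  [exists h in Delta l T, (dist T (nmap a) h)%:Z <= r].

Lemma dist_empty a : a \in I -> dist T (nmap a) finset.set0 = k.
Proof. by move=> aI; rewrite dist_set0 (index_sum aI). Qed.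

Lemma DeltaP l h : reflect (h \subset T /\ #|h| = l.+1) (h \in Delta l T).
Proof. by rewrite inE; apply: (iffP andP) => -[? /eqP]. Qed.

(** Two distinct vertices meet in the empty set, at distance k > 2 rv. *)
Lemma close_vertex_uniq a v w : a \in I -> v \in T -> w \in T ->
  (dist T (nmap a) [set v]%SET)%:Z <= rv -> (dist T (nmap a) [set w]%SET)%:Z <= rv -> v = w.
Proof.
move=> aI vT wT av aw; apply/eqP; apply: contraT => vw.
have := dist_cap [set v]%SET [set w]%SET (nmap a).
rewrite (_ : _ :&: _ = finset.set0) ?dist_empty //; first by lia.
by apply/finset.setP => u; rewrite !inE; apply: contraNF vw => /andP[/eqP <- /eqP <-].
Qed.

Lemma close_vertexE a : close 0 rv a =
  [exists v in T, (dist T (nmap a) [set v]%SET)%:Z <= rv].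
Proof.
apply/existsP/existsP => [[h /andP[/DeltaP[hT /eqP/cards1P[v hv]] ah]]|[v /andP[vT av]]].
  by exists v; rewrite -hv ah andbT -finset.sub1set -hv.
by exists [set v]%SET; rewrite av andbT; apply/DeltaP; rewrite finset.sub1set cards1.
Qed.

Lemma cap_card g h l : #|g| = l.+1 -> #|h| = l.+1 -> g != h -> (#|g :&: h| <= l)%N.
Proof.
move=> gl hl; apply: contraR; rewrite -ltnNge => cl.
have /eqP e1 : g :&: h == g by rewrite eqEcard subsetIl gl.
have /eqP e2 : g :&: h == h by rewrite eqEcard subsetIr hl.
by rewrite -e1 e2.
Qed.

Lemma close_edge_uniq a e e' : a \in I -> ~~ close 0 rv a ->
  e \in Delta 1 T -> e' \in Delta 1 T ->
  (dist T (nmap a) e)%:Z <= re -> (dist T (nmap a) e')%:Z <= re -> e = e'.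
Proof.
move=> aI nv /DeltaP[eT e2] /DeltaP[e'T e'2] ae ae'; apply/eqP; apply: contraT => ee'.
have := dist_cap e e' (nmap a); have := cap_card e2 e'2 ee'.
case c: #|_| => [|[|//]] _ dc.
  by move/eqP: c; rewrite cards_eq0 => /eqP c; move: dc; rewrite c dist_empty //; lia.
case/negP: nv; apply/existsP; exists (e :&: e'); apply/andP; split; last by lia.
by apply/DeltaP; split => //; apply: fintype.subset_trans eT; exact: subsetIl.
Qed.

(** The distance to the intersection is at most 2 rf <= re, so an edge or a vertex there would be
    close. Since T is an arbitrary finite set here, an empty intersection is also ruled out. *)
Lemma close_face_uniq a f f' : a \in I -> ~~ close 0 rv a -> ~~ close 1 re a ->
  f \in Delta 2 T -> f' \in Delta 2 T ->
  (dist T (nmap a) f)%:Z <= rf -> (dist T (nmap a) f')%:Z <= rf -> f = f'.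
Proof.
move=> aI nv ne /DeltaP[fT f2] /DeltaP[f'T f'2] af af'; apply/eqP; apply: contraT => ff'.
have := dist_cap f f' (nmap a); have cf := cap_card f2 f'2 ff' => dc.
have sT : f :&: f' \subset T by apply: fintype.subset_trans fT; exact: subsetIl.
move: cf dc; case c: #|_| => [|[|[|//]]] _ dc.
- by move/eqP: c; rewrite cards_eq0 => /eqP c; move: dc; rewrite c dist_empty //; lia.
- by case/negP: nv; apply/existsP; exists (f :&: f'); apply/andP; split; [exact/DeltaP|lia].
- by case/negP: ne; apply/existsP; exists (f :&: f'); apply/andP; split; [exact/DeltaP|lia].
Qed.

Lemma index_bubbleE a : a \in I ->
  (a \in bubble_index T k [:: rv; re; rf]) = [&& ~~ close 0 rv a, ~~ close 1 re a & ~~ close 2 rf a].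
Proof.
move=> aI; move: (aI); rewrite /I mem_index0 => /andP[a0 sa].
rewrite inE a0 sa /=; apply/forallP/and3P => [ra|[/existsP nv /existsP ne /existsP nf] l].
  by split; apply/existsP => -[h /andP[hD]]; rewrite leNgt => /negP; apply;
    [have := ra ord0|have := ra 1%R|have := ra 2%:R] => /forallP/(_ h)/implyP/(_ hD).
apply/forallP => h; apply/implyP => hD; rewrite ltNge; apply/negP => ah.
case: l hD ah => [[|[|[|//]]] /= _] hD ah; [apply: nv|apply: ne|apply: nf]; exists h;
  by rewrite hD.
Qed.

Lemma card_index_partition : #|I| =
  (\sum_(v in T) #|[set a in I | ((dist T (nmap a) [set v]%SET)%:Z <= rv)%R]|
   + \sum_(e in Delta 1 T) #|[set a in I | ~~ close 0 rv a && ((dist T (nmap a) e)%:Z <= re)%R]|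
   + \sum_(f in Delta 2 T) #|[set a in I | [&& ~~ close 0 rv a, ~~ close 1 re a &
        ((dist T (nmap a) f)%:Z <= rf)%R]]|
   + #|bubble_index T k [:: rv; re; rf]|)%N.
Proof.
have cardE (B : pred {ffun V -> 'I_k.+1}) : #|[set a in I | B a]| = (\sum_(a in I) B a)%N.
  rewrite -sum1_card [RHS]big_mkcond [LHS]big_mkcond; apply: eq_bigr => a _.
  by rewrite inE; case: (a \in I) => //=; case: (B a).
have -> : bubble_index T k [:: rv; re; rf] =
    [set a in I | [&& ~~ close 0 rv a, ~~ close 1 re a & ~~ close 2 rf a]].
  apply/finset.setP => a; rewrite [RHS]inE; case: (boolP (a \in I)) => [/index_bubbleE //|aI /=].
  by apply/negbTE; apply: contra aI; exact: (fintype.subsetP (index_sub _ _ _)).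
rewrite cardE; under eq_bigr do rewrite cardE.
under [X in (_ + X + _ + _)%N]eq_bigr do rewrite cardE.
under [X in (_ + X + _)%N]eq_bigr do rewrite cardE.
(* After exchanging sums it remains to see, for each exponent, that exactly one of the four
   indicators equals 1. *)
rewrite exchange_big [X in (_ + X + _ + _)%N]exchange_big [X in (_ + X + _)%N]exchange_big.
rewrite -!big_split -sum1_card; apply: eq_bigr => a aI /=.
rewrite (sum_at_most_one (fun v w vT wT => @close_vertex_uniq a v w aI vT wT)) -close_vertexE.
case nv: (close 0 rv a) => /=; first by rewrite !big1.
rewrite (sum_at_most_one (fun e e' eT e'T => @close_edge_uniq a e e' aI (negbT nv) eT e'T)).
rewrite -/(close 1 re a).
case ne: (close 1 re a) => /=; first by rewrite !big1.
rewrite (sum_at_most_one (fun f f' fT f'T => @close_face_uniq a f f' aI (negbT nv) (negbT ne) fT f'T)).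
by rewrite -/(close 2 rf a); case: (close 2 rf a).
Qed.

End BernsteinIndices.

Lemma card_fibers (X : finType) (S : {set X}) (f : X -> nat) N :
  (forall a, a \in S -> (f a < N)%N) ->
  #|S| = (\sum_(j < N) #|[set a in S | f a == j]|)%N.
Proof.
move=> fN; have cE (j : 'I_N) : #|[set a in S | f a == j]| = (\sum_(a in S) (f a == j))%N.
  rewrite -sum1_card [RHS]big_mkcond [LHS]big_mkcond; apply: eq_bigr => a _.
  by rewrite inE; case: (a \in S) => //=; case: (f a == j).
under eq_bigr do rewrite cE; rewrite exchange_big -sum1_card; apply: eq_bigr => a aS.
rewrite (bigD1 (Ordinal (fN a aS))) //= eqxx big1 // => j jn; apply/eqP; rewrite eqb0.
by apply: contra jn => /eqP fj; apply/eqP/val_inj.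
Qed.

(** * Each class of exponents has as many elements as its degrees of freedom *)

Section NumberOfDofs.
Context {R : realType} {V : finType}.
Notation E := ('rV[R]_3).
Notation poly3 := (mpoly 3 R).
Variables (x : V -> E) (T : {set V}) (L : V -> poly3) (dl : E -> V -> R).
Hypotheses (hT : tetrahedron x T) (hL : bary_polys x T L dl).
Variables (rv re rf : int) (k : nat).
Hypotheses (hrf : -1 <= rf) (hre : -1 <= re) (hrv : -1 <= rv)
  (hef : 2 * rf <= re) (hve : 2 * re <= rv) (hk : 2 * rv + 1 <= k%:Z).
Implicit Types (g h : {set V}) (a : {ffun V -> 'I_k.+1}).

(* [lia] identifies neither convertible atoms nor, in a large context, the
   relevant hypotheses. *)
Local Ltac index_lia :=
  repeat (let D := fresh "D" in set D := dist _ _ _; clearbody D);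
  repeat (let B := fresh "B" in set B := (\sum_(v in _) _)%N; clearbody B);
  repeat (let m := fresh "m" in set m := nat_of_ord _; clearbody m);
  move: hrf hre hrv hef hve hk; clear; lia.

Let I := bubble_index T k [::].

Lemma set_sub_index (B : pred {ffun V -> 'I_k.+1}) : [set a in I | B a] \subset I.
Proof. by apply/fintype.subsetP => a; rewrite inE => /andP[]. Qed.

Lemma far_vertex a v : ~~ close T 0 rv a -> v \in T -> rv < (dist T (nmap a) [set v]%SET)%:Z.
Proof.
rewrite close_vertexE negb_exists => /forallP/(_ v) nv vT.
by move: nv; rewrite vT /= -ltNge.
Qed.

Lemma dist_vertex a v : a \in I -> v \in T -> (a v + dist T (nmap a) [set v]%SET = k)%N.
Proof.
move=> aI vT; rewrite -[RHS](index_sum aI) (bigD1 v vT) /=; congr (_ + _)%N; rewrite /dist /nmap.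
by apply: eq_bigl => u; rewrite !inE andbC.
Qed.

(** Closeness to v means a v >= k - rv; subtracting k - rv there leaves an arbitrary exponent of
    degree rv on T. For rv = -1 both sides are empty. *)
Lemma card_close_vertex v : v \in T ->
  #|[set a in I | ((dist T (nmap a) [set v]%SET)%:Z <= rv)%R]| =
  #|{: bmultinom 3 (norders rv)}|.
Proof.
move=> vT; case: (leP 0 rv) => rv0; last first.
  have -> : norders rv = 0%N by rewrite /norders; lia.
  rewrite (eq_card0 (A := [set a in I | _])) => [|a]; last first.
    by rewrite inE; apply/negbTE/negP => /andP[_]; lia.
  by apply/esym/eq_card0 => -[m m0].
have [n rvE] : exists n : nat, rv = n by exists (absz rv); lia.
have -> : norders rv = n.+1 by rewrite /norders rvE; lia.
rewrite (card_bmultinom3 hT hL).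
apply: (card_shift (s := fun u => if u == v then (k - n)%N else 0%N) (t := fun=> 0%N) (subxx T)) => //.
- exact: set_sub_index.
- rewrite (bigD1 v vT) /= eqxx big1 => [|u /andP[_ /negPf ->]//].
  by rewrite finset.setDv big_set0 !addn0 subnKC //; lia.
- move=> a; rewrite inE => /andP[aI av]; split=> [u uT|u]; last by rewrite finset.setDv inE.
  by case: eqP => // ->; have := dist_vertex aI vT; move: av hk; rewrite rvE; index_lia.
- move=> a b aI bI ab _; rewrite bI inE aI /=.
  by have := dist_vertex aI vT; have := ab v vT; move: hk; rewrite eqxx rvE; index_lia.
Qed.

Lemma dist_add g a v : v \in T -> v \notin g ->
  dist T (nmap a) g = (a v + dist T (nmap a) (v |: g)%SET)%N.
Proof.
move=> vT vg; rewrite /dist (bigD1 v) /=; last by rewrite inE vg.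
congr (_ + _)%N; apply: eq_bigl => u; rewrite !inE negb_or andbC.
by case: (u == v).
Qed.

Lemma sum_eq_dist g a : a \in I -> g \subset T ->
  (\sum_(v in g) a v + dist T (nmap a) g = k)%N.
Proof.
by move=> aI gT; rewrite -[RHS](index_sum aI) [RHS](big_setID g) /= (finset.setIidPr gT).
Qed.

(** The distance j and the exponent i at one opposite vertex play the part of the pair of normal
    derivatives; what is left is an exponent on e with both entries at least s = rv + 1 - j. *)
Lemma card_close_edge e : e \in Delta 1 T ->
  #|[set a in I | ~~ close T 0 rv a && ((dist T (nmap a) e)%:Z <= re)%R]| =
  (\sum_(j < norders re) \sum_(i < j.+1)
     dim_on (simplex x e) (@polyspace R (k%:Z - 2 * (rv + 1) + j%:Z)%R))%N.
Proof.
move=> /DeltaP[eT e2].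
have /cards2P[v0 [v1 [v01 eE]]] : #|e| == 2%N by rewrite e2.
have /cards2P[y [z [yz TeE]]] : #|T :\: e| == 2%N by rewrite (card_TD hT eT e2).
have sum_e (F : V -> nat) : (\sum_(v in e) F v = F v0 + F v1)%N.
  by rewrite eE finset.big_setU1 ?inE //= finset.big_set1.
have sum_Te (F : V -> nat) : (\sum_(v in T :\: e) F v = F y + F z)%N.
  by rewrite TeE finset.big_setU1 ?inE //= finset.big_set1.
have v0e : v0 \in e by rewrite eE !inE eqxx.
have v1e : v1 \in e by rewrite eE !inE eqxx orbT.
have v0T := fintype.subsetP eT _ v0e; have v1T := fintype.subsetP eT _ v1e.
have e0 : e != finset.set0 by rewrite -card_gt0 e2.
set S := [set a in I | _].
rewrite (card_fibers (f := fun a => dist T (nmap a) e) (N := norders re)); last first.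
  by move=> a; rewrite inE => /and3P[_ _]; rewrite /norders; lia.
apply: eq_bigr => -[j jN] _ /=.
rewrite (card_fibers (f := fun a => nat_of_ord (a y)) (N := j.+1)); last first.
  by move=> a; rewrite inE ltnS => /andP[_ /eqP <-]; rewrite /dist sum_Te leq_addr.
apply: eq_bigr => -[i ij] _ /=; set A := [set a in _ | _].
have jre : j%:Z <= re by move: jN; rewrite /norders; lia.
pose s : nat := absz (rv + 1 - j%:Z)%R.
have AS a : a \in A -> [/\ a \in S, dist T (nmap a) e = j & a y = i :> nat].
  by rewrite inE => /andP[]; rewrite inE => /andP[-> /eqP ? /eqP ?].
have AI : A \subset I.
  by apply/fintype.subsetP => a /AS[]; rewrite inE => /andP[].
have hA a : a \in A -> [/\ a \in I, ~~ close T 0 rv a, dist T (nmap a) e = j & a y = i :> nat].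
  by move=> /AS[]; rewrite inE => /and3P[-> -> _].
have near_e a : a \in I -> (a v0 + a v1 + dist T (nmap a) e = k)%N.
  by move=> aI; have := sum_eq_dist aI eT; rewrite (sum_e (fun v => nat_of_ord (a v))).
(* The distance to v1 equals k - a v1 = a v0 + j, so being far from one endpoint bounds the exponent
   at the other. *)
have s_le a v : a \in A -> v \in e -> (s <= a v)%N.
  move=> /hA[aI nc de _] ve.
  have d0 := far_vertex nc v0T; have d1 := far_vertex nc v1T.
  have := dist_vertex aI v0T; have := dist_vertex aI v1T; have := near_e a aI.
  rewrite de; move: d0 d1 jre.
  by move: ve; rewrite /s eE !inE => /orP[/eqP ->|/eqP ->]; index_lia.
(* A negative test degree means 2 s > k - j, which leaves no exponent either. *)
case: (ltP (k%:Z - 2 * (rv + 1) + j%:Z) 0) => d0.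
  rewrite dim_polyspace_neg //; apply/eq_card0 => a; apply/negbTE/negP => aA.
  have [aI _ de _] := hA a aA; have := s_le a v0 aA v0e; have := s_le a v1 aA v1e.
  by have := near_e a aI; move: d0; rewrite de /s; index_lia.
have [d dE] : exists d : nat, k%:Z - 2 * (rv + 1) + j%:Z = d%:Z.
  by exists (absz (k%:Z - 2 * (rv + 1) + j%:Z)%R); lia.
rewrite dE (dim_polyspace hT hL) //.
apply: (card_shift (s := fun=> s) (t := fun v => if v == y then i else (j - i)%N) eT) => //.
- by rewrite sum_e sum_Te eqxx [z == y]eq_sym (negPf yz) /s; move: dE jre ij; index_lia.
- move=> a aA; split=> [v|v]; first exact: s_le.
  have [_ _ + ay] := hA a aA; rewrite /dist sum_Te /nmap ay => de.
  by rewrite TeE !inE => /orP[/eqP ->|/eqP ->]; rewrite ?eqxx // [z == y]eq_sym (negPf yz); move: de; index_lia.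
- move=> a b aI bI ab at_; rewrite bI.
  have ye : y \in T :\: e by rewrite TeE !inE eqxx.
  have ze : z \in T :\: e by rewrite TeE !inE eqxx orbT.
  have ay := at_ y ye; have az := at_ z ze; rewrite eqxx in ay.
  rewrite [z == y]eq_sym (negPf yz) in az.
  have de : dist T (nmap a) e = j by rewrite /dist sum_Te /nmap ay az subnKC.
  suff nc : ~~ close T 0 rv a by rewrite inE ay eqxx andbT inE de eqxx andbT inE aI nc de jre.
  have := near_e a aI; have := ab v0 v0e; have := ab v1 v1e.
  rewrite close_vertexE => h1 h0 h2; apply/existsP => -[v /andP[vT av]].
  have := dist_vertex aI vT; have [ve|ve] := boolP (v \in e).
    by move: ve; rewrite eE !inE => /orP[/eqP vE|/eqP vE]; subst v;
      move: av h0 h1 h2 jre; rewrite de /s; index_lia.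
  (* A vertex off the edge carries at most j <= re, so its distance, at least k - re, exceeds rv. *)
  have : (a v <= dist T (nmap a) e)%N by rewrite (dist_add a vT ve) leq_addr.
  by move: av jre; rewrite de; index_lia.
Qed.

(** Fixing the exponent j at the opposite vertex w leaves an exponent of degree k - j on f.
    Distances to faces of f drop by j, which gives the bubble bounds; vertices and edges not in f
    must be far automatically. *)
Lemma card_close_face f : f \in Delta 2 T ->
  #|[set a in I | [&& ~~ close T 0 rv a, ~~ close T 1 re a &
        ((dist T (nmap a) f)%:Z <= rf)%R]]| =
  (\sum_(j < norders rf)
     dim_on (simplex x f) (bubble x f (k - j) [:: (rv - j%:Z)%R; (re - j%:Z)%R]))%N.
Proof.
move=> /DeltaP[fT f3].
have /cards1P[w TfE] : #|T :\: f| == 1%N by rewrite (card_TD hT fT f3).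
have sum_Tf (F : V -> nat) : (\sum_(v in T :\: f) F v = F w)%N.
  by rewrite TfE finset.big_set1.
have f0 : f != finset.set0 by rewrite -card_gt0 f3.
have wTf : w \in T :\: f by rewrite TfE inE.
have wf : w \notin f by move: wTf; rewrite inE => /andP[].
have fTw v : v \in T -> v \notin f -> v = w.
  by move=> vT vf; apply/eqP; rewrite -finset.in_set1 -TfE inE vf.
set S := [set a in I | _].
rewrite (card_fibers (f := fun a => dist T (nmap a) f) (N := norders rf)); last first.
  by move=> a; rewrite inE => /and4P[_ _ _]; rewrite /norders; lia.
apply: eq_bigr => -[j jN] _ /=; set A := [set a in _ | _].
have jrf : j%:Z <= rf by move: jN; rewrite /norders; lia.
rewrite (dim_bubble hT hL) //.
have AI : A \subset I.
  by apply/fintype.subsetP => a; rewrite inE => /andP[]; rewrite inE => /andP[].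
have jk : (j <= k)%N by move: jrf; index_lia.
apply: (card_shift (s := fun=> 0%N) (t := fun=> j) fT) => //.
- exact: index_sub.
- by rewrite sum_Tf big1 // addn0 subnK.
- move=> a; rewrite inE => /andP[_ /eqP]; rewrite /dist sum_Tf => aw; split=> // v.
  by rewrite TfE inE => /eqP ->.
move=> a b aI bI ab at_.
have aw : a w = j :> nat by exact: at_.
have df : dist T (nmap a) f = j by rewrite /dist sum_Tf.
have dh h : h \subset f -> dist T (nmap a) h = ((\sum_(v in f :\: h) b v) + j)%N.
  move=> hf; rewrite /dist (big_setID f) /= addnC [RHS]addnC; congr (_ + _)%N.
    rewrite (_ : _ :\: f = [set w]%SET) ?finset.big_set1 //.
    apply/finset.setP => v; rewrite -TfE !inE; case vf: (v \in f) => //=.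
    by rewrite (negPf (contra (fintype.subsetP hf v) (negbT vf))).
  apply: eq_big => [v|v].
    rewrite !inE; case vf: (v \in f); rewrite ?andbT ?andbF //.
    by rewrite (fintype.subsetP fT v vf) andbT.
  by rewrite !inE => /andP[_ vf]; rewrite /nmap -ab // addn0.
have -> : (a \in A) = ~~ close T 0 rv a && ~~ close T 1 re a.
  transitivity ((a \in S) && (dist T (nmap a) f == j)); first by rewrite [LHS]inE.
  transitivity ([&& a \in I, ~~ close T 0 rv a, ~~ close T 1 re a &
      (dist T (nmap a) f)%:Z <= rf] && (dist T (nmap a) f == j)); first by rewrite [X in X && _ = _]inE.
  by rewrite aI df jrf eqxx !andbT.
have -> : (b \in bubble_index f (k - j) [:: rv - j%:Z; re - j%:Z]) =
   [forall h in Delta 0 f, rv - j%:Z < (\sum_(v in f :\: h) b v)%N%:Z] &&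
   [forall h in Delta 1 f, re - j%:Z < (\sum_(v in f :\: h) b v)%N%:Z].
  move: bI; rewrite mem_index0 inE => /andP[-> ->] /=.
  apply/forallP/andP => [H|[H0 H1] [[|[|//]] /= _] //].
  by split; [exact: (H ord0)|exact: (H (lift ord0 ord0))].
apply/andP/andP => -[c0 c1]; split.
- apply/forallP => h; apply/implyP; rewrite inE => /andP[hf hc].
  move: c0; rewrite negb_exists => /forallP/(_ h); rewrite inE hc (fintype.subset_trans hf fT) /=.
  by rewrite (dh _ hf); move: jrf; index_lia.
- apply/forallP => h; apply/implyP; rewrite inE => /andP[hf hc].
  move: c1; rewrite negb_exists => /forallP/(_ h); rewrite inE hc (fintype.subset_trans hf fT) /=.
  by rewrite (dh _ hf); move: jrf; index_lia.
- rewrite close_vertexE; apply/existsP => -[v /andP[vT]]; have [vf|vf] := boolP (v \in f).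
    have vs : [set v]%SET \subset f by rewrite finset.sub1set.
    have /forallP/(_ [set v]%SET) := c0; rewrite inE cards1 vs /= => h0.
    by move: h0 jrf; rewrite (dh _ vs); index_lia.
  by have := dist_vertex aI vT; move: jrf; rewrite (fTw v vT vf) aw; index_lia.
- apply/existsP => -[h /andP[/DeltaP[hT' h2] ah]]; have [hf|hf] := boolP (h \subset f).
    have /forallP/(_ h) := c1; rewrite inE h2 hf /= => h0.
    by move: ah h0 jrf; rewrite (dh _ hf); index_lia.
  (* An edge not in f is {w, u} with u in f; were it close, the distance to u would be at most j +
     re <= rf + re <= rv, against the bound at u. *)
  have wh : w \in h.
    case/subsetPn: hf => v vh vf.
    by rewrite -(fTw v (fintype.subsetP hT' v vh) vf).
  have wT : w \in T by move: wTf; rewrite inE => /andP[].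
  have /cards1P[u hu] : #|h :\ w| == 1%N by move: h2; rewrite (cardsD1 w h) wh add1n => -[->].
  have : u \in h :\ w by rewrite hu inE.
  rewrite !inE => /andP[uw uh].
  have uT := fintype.subsetP hT' u uh.
  have uf : u \in f by apply: contraNT uw => uf; rewrite (fTw u uT uf).
  have vs : [set u]%SET \subset f by rewrite finset.sub1set.
  have /forallP/(_ [set u]%SET) := c0; rewrite inE cards1 vs /= -(ltrD2r j%:Z) subrK -PoszD -(dh _ vs).
  have := @dist_add [set u]%SET a w wT; rewrite inE eq_sym uw => /(_ isT) ->.
  have -> : (w |: [set u])%SET = h by rewrite -hu finset.setD1K.
  by move: ah jrf; rewrite aw; index_lia.
Qed.

Lemma number_of_dofsE :
  number_of_dofs x rv re rf k T = dim_on (simplex x T) (@polyspace R k%:Z).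
Proof.
have T0 := card_T_neq0 hT.
rewrite (dim_polyspace hT hL) // -/I (card_index_partition T hrf hre hrv hef hve hk).
rewrite /number_of_dofs (dim_bubble hT hL) //; congr (_ + _ + _ + _)%N.
- by apply: eq_bigr => v vT; rewrite card_close_vertex.
- by apply: eq_bigr => e eT; rewrite card_close_edge.
- by apply: eq_bigr => f fT; rewrite card_close_face.
Qed.

End NumberOfDofs.

(** * Degrees of freedom respect differences; derivatives and closedness for the mesh part *)

Section DofLinearity.
Context {R : realType} {V : finType}.
Notation E := ('rV[R]_3).
Notation poly3 := (mpoly 3 R).
Variables (x : V -> E) (T : {set V}) (L : V -> poly3) (dl : E -> V -> R).
Hypotheses (hT : tetrahedron x T) (hL : bary_polys x T L dl).
Implicit Types (g h : {set V}) (P Q : poly3) (u p : E) (r : {set V} -> int).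

Lemma dirsB s P Q : dirs s (P - Q) = dirs s P - dirs s Q.
Proof. by elim: s => //= i s ->; rewrite dirDB. Qed.

Lemma poly_integral_dofB g I (A : poly3 -> poly3) q P Q : g \subset T ->
  poly_integral x L g I -> (exists B, forall p, on_plane L g p -> q p = ev B p) ->
  A (P - Q) = A P - A Q ->
  I (fun p => ev (A (P - Q)) p * q p) =
  I (fun p => ev (A P) p * q p) - I (fun p => ev (A Q) p * q p).
Proof.
move=> gT [ext IB _] [B qB] AB.
have e C : I (fun p => ev C p * q p) = I (ev (C * B)).
  by apply: ext => p gp; rewrite evM qB //; exact: (simplex_plane hT hL gT gp).
rewrite !e -IB; congr I; apply/funext => p.
by rewrite AB !evM evB mulrBl.
Qed.

(** Turns single-valuedness into the vanishing of the degrees of freedom on a difference of two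
    polynomials. Test functions are first replaced by polynomials on the simplex, where the integral
    is additive. *)
Lemma dofB rv re rf k n1 n2 nf g l P Q : g \subset T -> dof x rv re rf k n1 n2 nf g l ->
  l (ev (P - Q)) = l (ev P) - l (ev Q).
Proof.
move=> gT; case=> [v s _ _|i j q g2 ij _ /polyspaceP[B _ ->]|j q g3 _ bq|q g4 bq].
- by rewrite !partials_ev dirsB evB.
- rewrite !iterD_ev.
  apply: (poly_integral_dofB (A := fun P => itD (n1 g) i (itD (n2 g) (j - i) P)) gT
    (int_edge_poly hT hL gT g2)); first by exists B.
  by rewrite !itDB.
- rewrite !iterD_ev.
  apply: (poly_integral_dofB (A := itD (nf g) j) gT (int_face_poly hT hL gT g3)).
    exact: (poly_of_bubble hT hL gT bq).
  exact: itDB.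
- have gE : g = T by apply/eqP; rewrite eqEcard gT hT.1 g4.
  rewrite {}gE in bq *.
  apply: (poly_integral_dofB (A := id) (subxx T) (int_tet_poly hT hL)) => //.
  exact: (poly_of_bubble hT hL (subxx T) bq).
Qed.

Lemma spn_dirs d r s P : spn T L d r P ->
  spn T L (d - size s) (fun g => r g - (size s)%:Z) (dirs s P).
Proof.
move=> dP; elim: s => [|i s IH] /=.
  rewrite subn0; apply: spn_sub dP => a; rewrite (_ : (fun _ => _) = r) //.
  by apply/funext => g; rewrite subr0.
rewrite subnS; apply: spn_sub (spn_dirD hL (e_ i) IH) => a.
suff -> : (fun g => r g - (size s).+1%:Z) = (fun g => r g - (size s)%:Z - 1) by [].
by apply/funext => g; lia.
Qed.

Lemma closed_simplex : closed (simplex x T).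
Proof.
rewrite (_ : simplex x T = \bigcap_(v in setT) [set p | 0 <= ev (L v) p]); last first.
  apply/seteqP; split=> p /=.
    by move/(simplex_bc hT hL p (subxx T)) => [_ p0] v _; have := p0 v; rewrite ffunE.
  move=> pL; apply/(simplex_bc hT hL p (subxx T)); split=> v.
    by move=> vT; rewrite (bc_notin hL).
  by rewrite ffunE; exact: pL.
apply: closed_bigI => v _; apply: (@closed_comp _ _ (ev (L v)) [set t | 0 <= t]).
  by move=> p _; exact: continuous_ev.
exact: closed_ge.
Qed.

End DofLinearity.

(** * Gluing polynomial pieces over a mesh *)

Section Gluing.
Context {R : realType} {V : finType}.
Notation E := ('rV[R]_3).
Notation poly3 := (mpoly 3 R).
Variables (x : V -> E) (Th : {set {set V}}) (Omega : set E).
Hypothesis mesh : conforming_mesh x Th Omega.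
Implicit Types (T : {set V}) (P : {set V} -> poly3) (p : E).

Lemma simplex_closed T : T \in Th -> closed (simplex x T).
Proof.
move=> TTh; have hT := mesh_tetrahedra mesh TTh.
by have [L [dl hL]] := bary_polys_exist hT; exact: (closed_simplex hT hL).
Qed.

(** There are finitely many tetrahedra and they are closed, so those missing p also miss a
    neighbourhood of p. *)
Lemma local_cover p : Omega p -> \forall q \near p,
  Omega q /\ exists T, [/\ T \in Th, simplex x T p & simplex x T q].
Proof.
move=> Op.
have nO : \forall q \near p, Omega q by apply: open_nbhs_nbhs; split => //; exact: mesh_open mesh.
have nT : \forall q \near p, forall T, T \in Th -> simplex x T q -> simplex x T p.
  apply: (@filter_forall E _ (fun T q => T \in Th -> simplex x T q -> simplex x T p) (nbhs p) _) => T.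
  have [TTh|nTh] := boolP (T \in Th); last by apply: nearW => q.
  have [pT|pT] := pselect (simplex x T p); first by apply: nearW => q.
  have oT : open (~` simplex x T) by apply: closed_openC; exact: simplex_closed.
  have : nbhs p (~` simplex x T) by apply: open_nbhs_nbhs; split.
  by apply: filterS => q nq _ /nq.
near=> q.
have Oq : Omega q by near: q.
split => //.
have : (\bigcup_(T in [set` Th]) simplex x T) q by rewrite -(mesh_cover mesh); exact: subset_closure.
move=> [T /= TTh qT]; exists T; split => //.
by move: T TTh qT; near: q.
Unshelve. all: by end_near.
Qed.

Lemma glued_continuous P (w : E -> R) :
  (forall T p, T \in Th -> simplex x T p -> Omega p -> w p = ev (P T) p) ->
  forall p, Omega p -> {for p, continuous w}.
Proof.
move=> wP p Op; suff : w q @[q --> p] --> w p by [].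
apply: (proj2 (@cvgrPdist_lt R R^o E (nbhs p) (nbhs_filter p) w (w p))) => e e0.
have nP : \forall q \near p, forall T, `|ev (P T) p - ev (P T) q| < e.
  apply: (@filter_forall E _ (fun T q => `|ev (P T) p - ev (P T) q| < e) (nbhs p) _) => T.
  by have /cvgrPdist_lt/(_ e e0) := @continuous_ev R (P T) p.
have lc := local_cover Op.
near=> q.
have [Oq [T [TTh pT qT]]] : Omega q /\ exists T, [/\ T \in Th, simplex x T p & simplex x T q].
  by near: q.
rewrite (wP T p) // (wP T q) //.
by move: T {TTh pT qT}; near: q.
Unshelve. all: by end_near.
Qed.

(** For small t the point p + t v lies in some tetrahedron containing p, so the difference quotient
    is that of one of finitely many polynomials, all with the same derivative at p. *)
Lemma glued_derive P (w : E -> R) (v : E) :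
  (forall T p, T \in Th -> simplex x T p -> Omega p -> w p = ev (P T) p) ->
  (forall T T' p, T \in Th -> T' \in Th -> simplex x T p -> simplex x T' p ->
     Omega p -> ev (dirD v (P T)) p = ev (dirD v (P T')) p) ->
  forall T p, T \in Th -> simplex x T p -> Omega p -> is_derive p v w (ev (dirD v (P T)) p).
Proof.
move=> wP dP T p TTh pT Op; set c := ev _ p.
suff quot : (fun t : R => t^-1 *: ((w \o shift p) (t *: v) - w p)) @ 0^' --> c.
  by split; [apply/cvg_ex; exists c|exact: cvg_lim].
apply/cvgrPdist_lt => e e0.
have nP : \forall t \near (0 : R)^', forall T', T' \in Th -> simplex x T' p ->
    `|c - t^-1 *: ((ev (P T') \o shift p) (t *: v) - ev (P T') p)| < e.
  apply: (@filter_forall R _ (fun T' t => T' \in Th -> simplex x T' p ->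
    `|c - t^-1 *: ((ev (P T') \o shift p) (t *: v) - ev (P T') p)| < e) _ _) => T'.
  have [T'Th|nTh] := boolP (T' \in Th); last by apply: nearW.
  have [pT'|pT'] := pselect (simplex x T' p); last by apply: nearW.
  have [dv dE] := is_derive_ev (P T') p v.
  have /cvgrPdist_lt/(_ e e0) := dv; rewrite -/(derive _ p v) dE.
  by apply: filterS => t; rewrite /c (dP T T' p).
have sh : (fun t : R => t *: v + p) @ 0^' --> p.
  have : {for 0, continuous (fun t : R => t *: v + p)}.
    by apply: cvgD; [apply: cvgZr_tmp; exact: cvg_id|exact: cvg_cst].
  move=> /continuous_withinNx; rewrite scale0r add0r; exact.
have lc := sh _ (local_cover Op).
near=> t.
have [Oq [T' [T'Th pT' qT']]] :
    Omega (t *: v + p) /\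
    exists T', [/\ T' \in Th, simplex x T' p & simplex x T' (t *: v + p)].
  by near: t.
rewrite /= (wP T' p) // (wP T' _ T'Th qT' Oq).
by move: T' T'Th pT' {qT'}; near: t.
Unshelve. all: by end_near.
Qed.

Lemma omega_covered p : Omega p -> exists2 T, T \in Th & simplex x T p.
Proof.
move=> Op; have : closure Omega p by exact: subset_closure.
by rewrite (mesh_cover mesh) => -[T TTh pT]; exists T.
Qed.

(** The partial derivative of a glued function is glued from the derived polynomials, which agree to
    one order less. *)
Lemma class_C_glued n P (w : E -> R) :
  (forall T p, T \in Th -> simplex x T p -> Omega p -> w p = ev (P T) p) ->
  (forall T T' p (s : seq 'I_3), T \in Th -> T' \in Th -> simplex x T p -> simplex x T' p ->
     (size s <= n)%N -> ev (dirs s (P T)) p = ev (dirs s (P T')) p) ->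
  class_C n Omega w.
Proof.
elim: n P w => [|n IH] P w wP dP; split=> //; try exact: glued_continuous wP.
move=> i; have dw := glued_derive (v := e_ i) wP
  (fun T T' p TTh T'Th pT pT' _ => dP T T' p [:: i] TTh T'Th pT pT' isT).
split=> [p Op|].
  by have [T TTh pT] := omega_covered Op; case: (dw T p TTh pT Op).
apply: (IH (fun T => dirD (e_ i) (P T))) => [T p TTh pT Op|T T' p s TTh T'Th pT pT' sn].
  by case: (dw T p TTh pT Op) => _ ->.
have rE Q : dirs s (dirD (e_ i) Q) = dirs (rcons s i) Q by rewrite /dirs foldr_rcons.
by rewrite !rE; apply: dP => //; rewrite size_rcons.
Qed.

End Gluing.

(** * Unisolvence, agreement across shared faces, and the theorem *)

Lemma unisolvent_tetrahedron (R : realType) (rv re rf : int) (k : nat)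
    (V : finType) (x : V -> 'rV[R]_3) (n1 n2 nf : {set V} -> 'rV[R]_3) (T : {set V}) :
  -1 <= rf -> -1 <= re -> -1 <= rv -> 2 * rf <= re -> 2 * re <= rv -> 2 * rv + 1 <= k%:Z ->
  tetrahedron x T -> normals_on x n1 n2 nf T -> unisolvent x rv re rf k n1 n2 nf T.
Proof.
move=> hrf hre hrv hef hve hk hT hn; have [L [dl hL]] := bary_polys_exist hT.
split; first exact: (number_of_dofsE hT hL).
move=> u /polyspaceP[P dP ->] P0 p _.
have -> : P = 0; last by rewrite ev0.
by apply: (vanishing_dofs0 hT hL hrf hre hrv hef hve hk hn dP) => h hT' l; apply: P0.
Qed.

(** The difference P T - P T' is one global polynomial, so it can be expanded in the coordinates of
    T alone and submitted to the elimination on the common face. *)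
Lemma conforming_order (R : realType) (rv re rf : int) (k : nat)
    (V : finType) (x : V -> 'rV[R]_3) (n1 n2 nf : {set V} -> 'rV[R]_3)
    (Th : {set {set V}}) (Omega : set 'rV[R]_3) (P : {set V} -> mpoly 3 R) (n : nat) :
  -1 <= rf -> -1 <= re -> -1 <= rv -> 2 * rf <= re -> 2 * re <= rv -> 2 * rv + 1 <= k%:Z ->
  n%:Z <= rf -> conforming_mesh x Th Omega ->
  (forall T, T \in Th -> normals_on x n1 n2 nf T) ->
  (forall T, T \in Th -> deg_le k%:Z (P T)) ->
  single_valued x rv re rf k n1 n2 nf Th (fun T => ev (P T)) ->
  forall T T' p (s : seq 'I_3), T \in Th -> T' \in Th -> simplex x T p -> simplex x T' p ->
     (size s <= n)%N -> ev (dirs s (P T)) p = ev (dirs s (P T')) p.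
Proof.
move=> hrf hre hrv hef hve hk nrf mesh hn dP sv T T' p s TTh T'Th pT pT' sn.
have [<- //|TT'] := eqVneq T T'.
have hT := mesh_tetrahedra mesh TTh; have [L [dl hL]] := bary_polys_exist hT.
pose g := T :&: T'; have gT : g \subset T by exact: subsetIl.
have pg : simplex x g p by rewrite /g -(mesh_conforming mesh TTh T'Th).
have g0 : g != finset.set0.
  apply/eqP => ge; case: pg => l [[l0 l1 _] _]; move: l1; rewrite big1 => [/eqP|v _].
    by rewrite eq_sym oner_eq0.
  by apply: l0; rewrite ge inE.
have g4 : (#|g| < 4)%N.
  have := subset_leq_card gT; rewrite hT.1 leq_eqVlt => /orP[/eqP g4|//].
  case/eqP: TT'; have hT' := mesh_tetrahedra mesh T'Th.
  have /eqP <- : g == T by rewrite eqEcard gT hT.1 g4.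
  by apply/eqP; rewrite eqEcard subsetIr hT'.1 g4.
have vg (h : {set V}) : h \subset g -> vanishing_dofs x rv re rf k n1 n2 nf h (P T - P T').
  move=> hg l dl'; have hT1 : h \subset T by exact: fintype.subset_trans hg gT.
  have hT2 : h \subset T' by apply: fintype.subset_trans hg _; exact: subsetIr.
  by rewrite (dofB hT hL _ _ hT1 dl') (sv T T' h l) ?subrr.
have [|r [dPP rm ro]] := stages hT hL hrf hre hrv hef hve hk (hn T TTh) gT _
    (bernstein hL (deg_leB (dP T TTh) (dP T' T'Th))) vg; first by [].
apply/eqP; rewrite -subr_eq0 -evB -dirsB; apply/eqP.
(* After size s <= n <= rf derivatives the bound at g is still nonnegative, since rf <= re <= rv
   when rf >= 0; every remaining monomial thus vanishes on the plane of g. *)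
apply: (spn_off gT g0 (simplex_plane hT hL gT pg) _ (spn_dirs hL s dPP)).
have : order rv re rf g <= r g by apply: ro => //; rewrite card_gt0 g0.
have : (0 < #|g|)%N by rewrite card_gt0.
move: g4; rewrite /order; case: #|g| => [//|[|[|[|//]]]] /= _ _; lia.
Qed.

Theorem theorem3p6 (R : realType) (m rv re rf : int) (k : nat)
    (hrf : rf = m) (hm : -1 <= m)
    (hre : Num.max (2 * rf) (-1) <= re)
    (hrv : Num.max (2 * re) (-1) <= rv)
    (hk : 2 * rv + 1 <= k%:Z)
    (V : finType) (x : V -> 'rV[R]_3) (n1 n2 nf : {set V} -> 'rV[R]_3) :
  (forall T : {set V}, tetrahedron x T -> normals_on x n1 n2 nf T ->
     unisolvent x rv re rf k n1 n2 nf T) /\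
  (forall (Th : {set {set V}}) (Omega : set 'rV[R]_3),
     conforming_mesh x Th Omega ->
     (forall T, T \in Th -> normals_on x n1 n2 nf T) ->
     forall u : {set V} -> 'rV[R]_3 -> R,
       (forall T, T \in Th -> polyspace k%:Z (u T)) ->
       single_valued x rv re rf k n1 n2 nf Th u ->
       fe_space x rv re rf k n1 n2 nf Th Omega m u).
Proof.
have [hef hre' hve hrv'] : [/\ 2 * rf <= re, -1 <= re, 2 * re <= rv & -1 <= rv].
  by move: hre hrv; rewrite !ge_max => /andP[? ?] /andP[? ?].
have hrf' : -1 <= rf by rewrite hrf.
split=> [T|Th Omega mesh hn u uk sv]; first exact: unisolvent_tetrahedron.
(* For m = -1 the continuity requirement is void. *)
split=> //; case: m hrf hm => [n rfE _|//].
have ex_poly (T : {set V}) : exists Q, T \in Th -> deg_le k%:Z Q /\ u T = ev Q.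
  have [/uk/polyspaceP[Q dQ uQ]|nT] := boolP (T \in Th); first by exists Q.
  by exists 0.
have [P PE] := choice ex_poly.
have svP : single_valued x rv re rf k n1 n2 nf Th (fun T => ev (P T)).
  move=> T T' g l TTh T'Th gT gT' gl.
  by rewrite -(PE T TTh).2 -(PE T' T'Th).2; apply: sv gl.
have agree := conforming_order hrf' hre' hrv' hef hve hk _ mesh hn
  (fun T TTh => (PE T TTh).1) svP.
have {}agree := agree n; rewrite rfE lexx in agree; move/(_ isT): agree => agree.
(* The global function evaluates, at each point, the polynomial of a chosen tetrahedron containing
   it; agreement of order 0 makes the choice irrelevant. *)
pose S p := [set T | T \in Th /\ simplex x T p].
have wE T p : T \in Th -> simplex x T p ->
    ev (P (xget finset.set0 (S p))) p = ev (P T) p.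
  move=> TTh pT; have [T'Th pT'] : S p (xget finset.set0 (S p)).
    by apply: (@xgetI _ _ _ T); split.
  exact: (agree _ _ p [::]).
exists (fun p => ev (P (xget finset.set0 (S p))) p); split=> [T p TTh pT _|].
  by rewrite (PE T TTh).2; exact: wE.
apply: (class_C_glued mesh (P := P)) => [T p TTh pT _|]; first exact: wE.
exact: agree.
Qed.
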